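(* Let $d\ge 1$ and for each $x\in\mathbb{R}^d$ let $a(x)=(a_{ij}(x))_{i,j=1}^d$ be a real symmetric $d\times d$ matrix. Suppose that the matrices $a(x)$ are bounded and uniformly positive definite, i.e. there exist constants $0<\Lambda_m\le\Lambda_M<\infty$ such that for all $x\in\mathbb{R}^d$ and all $z=(z_1,\dots,z_d)\in\mathbb{R}^d$ $$\Lambda_m\sum_{i=1}^d z_i^2\le \sum_{i,j=1}^d a_{ij}(x)z_iz_j\le \Lambda_M\sum_{i=1}^d z_i^2,$$ and that there exist constants $K>0$ and $\alpha>0$ such that $$|a_{ij}(x)-a_{ij}(y)|\le K\,(1\wedge |x-y|^\alpha)$$ for all $i,j=1,\dots,d$ and all $x,y\in\mathbb{R}^d$. Let $$\mathcal{L}f(x)=\sum_{i,j=1}^d a_{ij}(x)\,\frac{\partial^2 f}{\partial x_i\partial x_j}(x).$$ Then for each $w\in\mathbb{R}^d$ the solution to the martingale problem for $\mathcal{L}$ started at $w$ is unique; that is, if $\mathbb{P}_1$ and $\mathbb{P}_2$ are both solutions to the martingale problem for $\mathcal{L}$ started at $w$, then $\mathbb{P}_1=\mathbb{P}_2$.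
   Context: Let $\Omega=C([0,\infty),\mathbb{R}^d)$ be the set of continuous maps from $[0,\infty)$ to $\mathbb{R}^d$, with coordinate process $X_t(\omega)=\omega(t)$, equipped with the $\sigma$-field generated by the cylindrical sets and the filtration generated by $X$. Let $C_b^2$ be the class of $C^2$ functions $f:\mathbb{R}^d\to\mathbb{R}$ such that $f$ and all its first and second partial derivatives are bounded. A probability measure $\mathbb{P}$ on $\Omega$ is a solution of the martingale problem for $\mathcal{L}$ started at $w\in\mathbb{R}^d$ if $\mathbb{P}(X_0=w)=1$ and, for every $f\in C_b^2$, the process $f(X_t)-f(X_0)-\int_0^t \mathcal{L}f(X_s)\,ds$, $t\ge 0$, is a martingale with respect to $\mathbb{P}$. *)

(* Defs.v *)
From HB Require Import structures.
From mathcomp Require Import all_boot all_order all_algebra.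
From mathcomp Require Import all_classical all_reals all_analysis.

Set Implicit Arguments.
Unset Strict Implicit.
Unset Printing Implicit Defensive.

Import Order.TTheory GRing.Theory Num.Theory.
Import numFieldNormedType.Exports.

Local Open Scope classical_set_scope.
Local Open Scope ring_scope.

(* The library norm on ['rV[R]_d] is the sup norm; [enorm] is the Euclidean
   one. *)
Definition enorm (R : realType) (d : nat) (x : 'rV[R]_d) : R :=
  Num.sqrt (\sum_(i < d) x 0 i ^+ 2).

Definition borel (R : realType) (d : nat) : set (set 'rV[R]_d) :=
  <<s [set U : set 'rV[R]_d | open U] >>.

Definition time (R : realType) : set R := `[0, +oo[.

Definition continuous_paths (R : realType) (d : nat) : Type :=
  continuousType (@time R) 'rV[R]_d.

HB.instance Definition _ (R : realType) (d : nat) :=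
  Choice.on (continuous_paths R d).

HB.instance Definition _ (R : realType) (d : nat) :=
  isPointed.Build (continuous_paths R d)
    ((cst 0 : continuousType (@time R) 'rV[R]_d) : continuous_paths R d).

(* [coord_process t omega] is [omega t] for [0 <= t]. Negative times are never
   used; there ['valL_ 0] returns the dummy value [0]. *)
Definition coord_process (R : realType) (d : nat) (t : R)
    (omega : continuous_paths R d) : 'rV[R]_d :=
  'valL_ 0 (omega : @time R -> 'rV[R]_d) t.

Definition cylinders (R : realType) (d : nat) : set (set (continuous_paths R d)) :=
  [set C | exists (n : nat) (t : 'I_n -> R) (B : 'I_n -> set 'rV[R]_d),
     [/\ forall k, 0 <= t k, forall k, borel (B k) &
         C = [set omega | forall k, B k (coord_process (t k) omega)]]].

Definition Omega (R : realType) (d : nat) :=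
  g_sigma_algebraType (@cylinders R d).

(* The filtration [F_t = sigma(X_s, 0 <= s <= t)], not completed. *)
Definition coord_filtration (R : realType) (d : nat) (t : R)
  : set (set (Omega R d)) :=
  <<s [set C | exists (s : R) (B : set 'rV[R]_d),
     [/\ 0 <= s <= t, borel B & C = coord_process s @^-1` B]] >>.

Definition measurable_wrt (T : Type) (R : realType) (G : set (set T))
    (Y : T -> R) : Prop :=
  forall B : set R, measurable B -> G (Y @^-1` B).

(* [Y] is a version of the conditional expectation [E[Z | G]]. *)
Definition is_condexp (disp : measure_display) (T : measurableType disp)
    (R : realType) (P : probability T R) (G : set (set T)) (Z Y : T -> R)
  : Prop :=
  [/\ measurable_wrt G Y,
      P.-integrable setT (EFin \o Y) &
      forall A : set T, G A ->
        (\int[P]_(omega in A) (Y omega)%:E =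
         \int[P]_(omega in A) (Z omega)%:E)%E].

Definition martingale (disp : measure_display) (T : measurableType disp)
    (R : realType) (P : probability T R) (F : R -> set (set T))
    (M : R -> T -> R) : Prop :=
  [/\ forall t, 0 <= t -> measurable_wrt (F t) (M t),
      forall t, 0 <= t -> P.-integrable setT (EFin \o M t) &
      forall s t, 0 <= s -> s <= t -> is_condexp P (F s) (M t) (M s)].

Definition partial (R : realType) (d : nat) (i : 'I_d) (f : 'rV[R]_d -> R)
  : 'rV[R]_d -> R := 'D_(delta_mx 0 i) f.

Definition C1 (R : realType) (d : nat) (f : 'rV[R]_d -> R) : Prop :=
  continuous f /\
  forall i : 'I_d, (forall x, derivable f x (delta_mx 0 i)) /\
                   continuous (partial i f).

Definition C2 (R : realType) (d : nat) (f : 'rV[R]_d -> R) : Prop :=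
  C1 f /\ forall i : 'I_d, C1 (partial i f).

Definition Cb2 (R : realType) (d : nat) (f : 'rV[R]_d -> R) : Prop :=
  [/\ C2 f, bounded_fun f,
      forall i : 'I_d, bounded_fun (partial i f) &
      forall i j : 'I_d, bounded_fun (partial i (partial j f))].

Definition generator (R : realType) (d : nat) (a : 'rV[R]_d -> 'M[R]_d)
    (f : 'rV[R]_d -> R) (x : 'rV[R]_d) : R :=
  \sum_(i < d) \sum_(j < d) a x i j * partial i (partial j f) x.

Definition martingale_problem_solution (R : realType) (d : nat)
    (L : ('rV[R]_d -> R) -> 'rV[R]_d -> R) (w : 'rV[R]_d)
    (P : probability (Omega R d) R) : Prop :=
  P [set omega | coord_process 0 omega = w] = 1%E /\
  forall f : 'rV[R]_d -> R, Cb2 f ->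
    martingale P (@coord_filtration R d)
      (fun t omega =>
         f (coord_process t omega) - f (coord_process 0 omega) -
         (\int[@lebesgue_measure R]_(s in `[0, t]) L f (coord_process s omega))%R).

(* Main.v *)
Require Import Defs.
From HB Require Import structures.
From mathcomp Require Import all_boot all_order all_algebra.
From mathcomp Require Import all_classical all_reals all_analysis.
From mathcomp Require Import measurable_realfun ring lra.

Set Implicit Arguments.
Unset Strict Implicit.
Unset Printing Implicit Defensive.

Import Order.TTheory GRing.Theory Num.Theory.
Import numFieldNormedType.Exports.

Local Open Scope classical_set_scope.
Local Open Scope ring_scope.

(* Let [P1], [P2] be two solutions, [A] an event known at time [s0], and
   [gap t h] the difference of the integrals of [h (X_t)] over [A]. If [gap s0]
   vanishes, it vanishes on a time interval whose length depends on the
   coefficients only; iterating and conditioning on the past at finitely many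
   times identifies all finite-dimensional distributions.

   For the short-time statement let [G_y (T, x)] be the fundamental solution of
   [d/dT - L^y], where [L^y] has the coefficients of [L] frozen at the ENDPOINT
   [y]. As [G_y] is an explicit Gaussian, sums
     [g_s x = \sum_y f y * delta ^ d * G_y (eps + t - s, x)]
   over a grid of mesh [delta], [eps = delta ^ 2], are test functions, and
   [d/ds gap s g_s = gap s (\sum_y f y * delta ^ d * (L - L^y) G_y (eps + t - s, .))].
   By Hoelder continuity the argument is bounded by
   [C (eps + t - s) ^ (beta - 1)] uniformly in the grid, an integrable
   singularity, so that [gap t g_t <= C (eps + t - s0) ^ beta * M], [M] being the
   supremum of [gap] over [[s0, t]] and over continuous [`|f| <= 1]. On the other
   hand [g_t = N f + o(1)], where the weight [N] is bounded above and bounded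
   below by a positive constant; for an [f] nearly realizing the supremum at time
   [t] this gives [gap t g_t >= c0 * sup gap t]. Hence [M <= M / 2] over short
   intervals. Freezing at the endpoint and working with sums over a grid makes
   both the normalization of [G_y] and integration over [R^d] unnecessary. *)

(** * Paths and the canonical filtration *)

(** Clipping time at 0 extends a path to the whole line by its initial value. Without the clip, the
    dummy value of [coord_process] at negative times could produce a jump at 0. *)
Lemma coord_process_continuous (R : realType) (d : nat) (omega : Omega R d) :
  continuous (fun t : R => coord_process (Num.max t 0) omega).
Proof.
have clipP (t : R) : Num.max t 0 \in @time R.
  by rewrite inE /time/= in_itv/= andbT le_max lexx orbT.
pose clip (t : R) : @time R := exist _ (Num.max t 0) (clipP t).
have clip_continuous : continuous clip.
  apply/continuous_comp_initial => t.
  by apply: (@continuous_max R R (fun t : R => t) (fun=> 0) t); [exact: cvg_id|exact: cvg_cst].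
have -> : (fun t : R => coord_process (Num.max t 0) omega) =
    (omega : continuous_paths R d) \o clip.
  apply/funext => t /=; rewrite /coord_process.
  by rewrite -[in RHS](valLK 0 (omega : @time R -> 'rV[R]_d)).
move=> t; apply: continuous_comp; first exact: clip_continuous.
exact: (@cts_fun _ _ (omega : continuous_paths R d)).
Qed.

Lemma borel_preimage (R : realType) (d : nat) (f : 'rV[R]_d -> R) (B : set R) :
  continuous f -> measurable B -> borel (f @^-1` B).
Proof.
move=> cf mB.
have mf : measurable_fun [set: g_sigma_algebraType [set U : set 'rV[R]_d | open U]] f.
  apply: (measurability _ (RGenOpens.measurableE R)).
  move=> _ [_ [x [y ->]] <-]; rewrite setTI; apply: sub_sigma_algebra => /=.
  by apply: open_comp => [z _|]; [exact: cf|exact: interval_open].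
by have := mf measurableT _ mB; rewrite setTI.
Qed.

Lemma coord_process_cylinder (R : realType) (d : nat) (t : R) (B : set 'rV[R]_d) :
  0 <= t -> borel B -> measurable (@coord_process R d t @^-1` B : set (Omega R d)).
Proof.
move=> t0 bB; apply: sub_sigma_algebra.
exists 1%N, (fun=> t), (fun=> B); split => //.
by apply/seteqP; split => omega /= ; [move=> ? ?|move/(_ ord0)].
Qed.

Lemma measurable_coord_process (R : realType) (d : nat) (t : R) (f : 'rV[R]_d -> R) :
  0 <= t -> continuous f ->
  measurable_fun [set: Omega R d] (fun omega => f (coord_process t omega)).
Proof.
move=> t0 cf _ B mB; rewrite setTI.
exact: (coord_process_cylinder t0 (borel_preimage cf mB)).
Qed.

Lemma coord_filtration_measurable (R : realType) (d : nat) (t : R) :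
  0 <= t -> @coord_filtration R d t `<=` measurable.
Proof.
move=> t0; apply: smallest_sub; first exact: sigma_algebra_measurable.
by move=> _ [s [B [/andP[s0 _] bB ->]]]; exact: coord_process_cylinder.
Qed.

Lemma coord_filtrationS (R : realType) (d : nat) (s t : R) :
  s <= t -> @coord_filtration R d s `<=` @coord_filtration R d t.
Proof.
move=> st; apply: sub_smallest2r; first exact: smallest_sigma_algebra.
by move=> _ [u [B [/andP[u0 us] bB ->]]]; exists u, B; rewrite u0 (le_trans us).
Qed.

(** * Inverses of elliptic matrices *)

(** The square of [enorm]. Squares keep Gaussian exponents and Hoelder bounds free of roots, at the
    price of halving the Hoelder exponent. *)
Definition normsq (R : realType) (d : nat) (z : 'rV[R]_d) : R :=
  \sum_(i < d) z 0 i ^+ 2.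

Definition quad (R : realType) (d : nat) (A : 'M[R]_d) (z : 'rV[R]_d) : R :=
  \sum_(i < d) \sum_(j < d) A i j * z 0 i * z 0 j.

Lemma quadE (R : realType) (d : nat) (A : 'M[R]_d) (z : 'rV[R]_d) :
  quad A z = (z *m A *m z^T) 0 0.
Proof.
rewrite mxE /quad exchange_big /=; apply: eq_bigr => j _.
rewrite !mxE mulr_suml; apply: eq_bigr => i _.
ring.
Qed.

Lemma normsqE (R : realType) (d : nat) (z : 'rV[R]_d) : normsq z = (z *m z^T) 0 0.
Proof. by rewrite mxE; apply: eq_bigr => i _; rewrite mxE expr2. Qed.

Lemma normsq_ge0 (R : realType) (d : nat) (z : 'rV[R]_d) : 0 <= normsq z.
Proof. by apply: sumr_ge0 => i _; rewrite sqr_ge0. Qed.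

Lemma normsq_eq0 (R : realType) (d : nat) (z : 'rV[R]_d) : normsq z = 0 -> z = 0.
Proof.
move/eqP; rewrite psumr_eq0 => [/allP z0|i _]; last exact: sqr_ge0.
apply/rowP => i; rewrite mxE; apply/eqP.
by have := z0 i (mem_index_enum i); rewrite sqrf_eq0.
Qed.

Lemma coord_le_normsq (R : realType) (d : nat) (z : 'rV[R]_d) i : z 0 i ^+ 2 <= normsq z.
Proof.
rewrite /normsq (bigD1 i)//= lerDl; apply: sumr_ge0 => j _; exact: sqr_ge0.
Qed.

Section elliptic_inverse.
Context (R : realType) (d : nat) (a : 'M[R]_d) (Lm LM : R).
Hypotheses (a_sym : a^T = a) (Lm0 : 0 < Lm) (LmM : Lm <= LM).
Hypothesis a_ell : forall z : 'rV[R]_d,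
  Lm * normsq z <= quad a z /\ quad a z <= LM * normsq z.

Let LM0 : 0 < LM. Proof. exact: lt_le_trans LmM. Qed.

Lemma elliptic_unitmx : a \in unitmx.
Proof.
rewrite -row_free_unit; apply: inj_row_free => v va0.
have [+ _] := a_ell v; rewrite quadE va0 mul0mx mxE => vle0.
apply: normsq_eq0; apply/eqP; rewrite eq_le normsq_ge0 andbT.
by rewrite -(pmulr_rle0 _ Lm0).
Qed.

Lemma invmx_sym : (invmx a)^T = invmx a.
Proof. by rewrite trmx_inv a_sym. Qed.

Let quad_inv z : quad (invmx a) z = quad a (z *m invmx a).
Proof.
rewrite !quadE -(mulmxA z (invmx a) a) mulVmx ?elliptic_unitmx// mulmx1.
by rewrite trmx_mul invmx_sym mulmxA.
Qed.

(** With [u = z a^-1], ellipticity makes the form of [a] nonnegative at [u - z / LM]. Expand with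
    [u a = z] and bound the last term by [quad a z <= LM * normsq z]. *)
Lemma quad_inv_ge z : normsq z / LM <= quad (invmx a) z.
Proof.
set u := z *m invmx a.
have ua : u *m a = z by rewrite -mulmxA mulVmx ?elliptic_unitmx// mulmx1.
have [+ _] := a_ell (u - LM^-1 *: z).
have -> : quad a (u - LM^-1 *: z) =
    quad a u - 2 * LM^-1 * normsq z + LM^-1 ^+ 2 * quad a z.
  rewrite !quadE normsqE; set c := LM^-1.
  have -> : (u - c *: z)^T = u^T - c *: z^T by rewrite linearB linearZ.
  rewrite !mulmxBr !mulmxBl -!scalemxAr -!scalemxAl ua.
  have -> : z *m a *m u^T = z *m z^T.
    by have -> : z^T = a *m u^T; rewrite ?mulmxA// -[in LHS]ua trmx_mul a_sym.
  by rewrite !mxE; ring.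
have [_ aM] := a_ell z; have := normsq_ge0 (u - LM^-1 *: z).
rewrite quad_inv -/u => w0 h.
have : 0 <= quad a u - 2 / LM * normsq z + LM^-1 ^+ 2 * quad a z.
  by apply: le_trans h; rewrite mulr_ge0// ltW.
have : LM^-1 ^+ 2 * quad a z <= normsq z / LM.
  rewrite (le_trans (ler_wpM2l _ aM)) ?sqr_ge0//.
  by rewrite mulrA expr2 -mulrA -mulrA mulKf ?gt_eqF// mulrC.
lra.
Qed.

(** For [u = z a^-1] ellipticity gives [Lm |u|^2 <= u . z], and [0 <= |Lm u - z|^2] bounds
    [2 Lm (u . z)] by [Lm^2 |u|^2 + |z|^2]; together they leave [Lm^2 |u|^2 <= |z|^2]. *)
Lemma normsq_mul_inv_le z : normsq (z *m invmx a) <= normsq z / Lm ^+ 2.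
Proof.
set u := z *m invmx a.
have ua : u *m a = z by rewrite -mulmxA mulVmx ?elliptic_unitmx// mulmx1.
have [+ _] := a_ell u; rewrite quadE ua.
have -> : (z *m u^T) 0 0 = \sum_i u 0 i * z 0 i.
  by rewrite mxE; apply: eq_bigr => i _; rewrite mxE mulrC.
have : 0 <= \sum_i (Lm * u 0 i - z 0 i) ^+ 2 by apply: sumr_ge0 => i _; exact: sqr_ge0.
have -> : \sum_i (Lm * u 0 i - z 0 i) ^+ 2 =
    Lm ^+ 2 * normsq u - 2 * Lm * \sum_i u 0 i * z 0 i + normsq z.
  by rewrite /normsq !mulr_sumr -sumrB -big_split/=; apply: eq_bigr => i _; ring.
rewrite ler_pdivlMr ?exprn_gt0// => h1 h2; have : Lm * (Lm * normsq u) <= Lm * \sum_i u 0 i * z 0 i.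
  by rewrite ler_pM2l.
move: h1; set s := \sum_i _; set n := normsq u; set m := normsq z => h1 h3.
have -> : n * Lm ^+ 2 = Lm * (Lm * n) by ring.
have e : Lm ^+ 2 * n = Lm * (Lm * n) by ring.
move: h1; rewrite e -mulrA; lra.
Qed.

(** The same square [|Lm u - z|^2], now bounding [u . z] through the preceding estimate of
    [|u|^2]. *)
Lemma quad_inv_le z : quad (invmx a) z <= normsq z / Lm.
Proof.
have := normsq_mul_inv_le z; set u := z *m invmx a.
have -> : quad (invmx a) z = \sum_i u 0 i * z 0 i.
  by rewrite quadE mxE; apply: eq_bigr => i _; congr (_ * _); rewrite mxE.
have : 0 <= \sum_i (Lm * u 0 i - z 0 i) ^+ 2 by apply: sumr_ge0 => i _; exact: sqr_ge0.
have -> : \sum_i (Lm * u 0 i - z 0 i) ^+ 2 =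
    Lm ^+ 2 * normsq u - 2 * (Lm * \sum_i u 0 i * z 0 i) + normsq z.
  by rewrite /normsq !mulr_sumr -sumrB -big_split/=; apply: eq_bigr => i _; ring.
rewrite !ler_pdivlMr ?exprn_gt0// ![_ * Lm]mulrC [_ * Lm ^+ 2]mulrC.
set s := \sum_i _; set n := normsq u; set m := normsq z; set k := Lm * s; set l := Lm ^+ 2 * n; lra.
Qed.

Lemma invmx_entry_le i j : `|invmx a i j| <= Lm^-1.
Proof.
have := normsq_mul_inv_le (delta_mx 0 i); rewrite -rowE => h.
have : (invmx a i j) ^+ 2 <= Lm^-1 ^+ 2.
  have := coord_le_normsq (row i (invmx a)) j; rewrite mxE => /le_trans; apply.
  apply: le_trans h _; rewrite /normsq (bigD1 i)//= big1 ?addr0 => [|k ki].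
    by rewrite mxE !eqxx expr1n mul1r exprVn.
  by rewrite mxE eqxx/= (negbTE ki) expr0n.
by rewrite -ler_sqrt ?sqr_ge0// !sqrtr_sqr (ger0_norm (_ : 0 <= Lm^-1))// invr_ge0 ltW.
Qed.

Lemma mul_inv_coord_le z i : ((z *m invmx a) 0 i) ^+ 2 <= normsq z / Lm ^+ 2.
Proof. exact: le_trans (coord_le_normsq _ _) (normsq_mul_inv_le z). Qed.

End elliptic_inverse.

(** * Gaussian sums over a lattice *)

Section lattice.
Context (R : realType).

(* Lattice sums telescope against this bounded increasing function. *)
Let sat (u : R) : R := u / (1 + `|u|).

Let sat_le1 u : `|sat u| <= 1.
Proof.
rewrite /sat normrM normfV (ger0_norm (_ : 0 <= 1 + `|u|)) ?addr_ge0//.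
by rewrite ler_pdivrMr ?mul1r ?lerDr// ltr_pwDl.
Qed.

(** [sat] has derivative [1 / (1 + |u|)^2]; over a step [r <= 1] the absolute value of the argument
    grows by at most 1, whence the 2 in the denominator. *)
Let sat_increment u r : 0 < r -> r <= 1 -> r / (2 + `|u|) ^+ 2 <= sat (u + r) - sat u.
Proof.
move=> r0 r1; set v := u + r; have p1 : 0 < 1 + `|u| by rewrite ltr_pwDl.
have p2 : 0 < 1 + `|v| by rewrite ltr_pwDl.
have vu : `|v| <= `|u| + 1 by rewrite (le_trans (ler_normD _ _))// lerD2l ger0_norm// ltW.
have cross : u * `|v| <= v * `|u|.
  have uv : u <= v by rewrite lerDl ltW.
  have [u0|u0] := lerP 0 u.
    by rewrite (ger0_norm u0) ger0_norm ?(le_trans u0)// mulrC.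
  rewrite (ltr0_norm u0); have [v0|v0] := lerP 0 v.
    by rewrite (ger0_norm v0); nra.
  by rewrite (ltr0_norm v0); nra.
apply: (@le_trans _ _ (r / ((1 + `|u|) * (1 + `|v|)))).
  rewrite ler_pM2l// lef_pV2 ?posrE ?mulr_gt0 ?exprn_gt0 ?ltr_pwDl//.
  by rewrite expr2 ler_pM ?addr_ge0//; lra.
have -> : sat v - sat u = (v - u + (v * `|u| - u * `|v|)) / ((1 + `|u|) * (1 + `|v|)).
  by rewrite /sat; field; rewrite !gt_eqF.
have -> : v - u = r by rewrite /v; ring.
by rewrite ler_pM2r ?invr_gt0 ?mulr_gt0// lerDl subr_ge0.
Qed.

(** Each term is at most the increment of [sat] over one lattice cell. The sum telescopes, so the
    oscillation 2 of [sat] bounds it whatever the step, the shift and the number of terms. *)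
Lemma lattice_sum1 (r x : R) (N : nat) : 0 < r -> r <= 1 ->
  \sum_(k < N) r / (2 + `|x - r * k%:R|) ^+ 2 <= 2.
Proof.
move=> r0 r1; pose s (k : nat) := sat (r - x + r * k%:R - r).
apply: (@le_trans _ _ (\sum_(0 <= k < N) (s k.+1 - s k))).
  rewrite big_mkord; apply: ler_sum => k _.
  have := sat_increment (r * k%:R - x) r0 r1; rewrite distrC /s.
  by congr (_ <= sat _ - sat _); rewrite -?natr1; ring.
rewrite telescope_sumr// /s; have := sat_le1 (r - x + r * N%:R - r).
have := sat_le1 (r - x + r * 0%:R - r); rewrite !ler_norml; lra.
Qed.

(** Brings a Gaussian below the profile of [lattice_sum1]. The constant satisfies [C (1 + c u^2) >=
    8 + 2 u^2 >= (2 + |u|)^2], and [1 + c u^2 <= expR (c u^2)]. *)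
Lemma expR_decay (c : R) : 0 < c -> exists2 C : R, 0 < C &
  forall u : R, expR (- (c * u ^+ 2)) <= C / (2 + `|u|) ^+ 2.
Proof.
move=> c0; exists (8 + 2 / c) => [|u]; first by rewrite addr_gt0// divr_gt0.
rewrite ler_pdivlMr ?exprn_gt0 ?ltr_pwDl//.
rewrite expRN mulrC ler_pdivrMr ?expR_gt0//.
have h1 : 1 + c * u ^+ 2 <= expR (c * u ^+ 2) by exact: expR_ge1Dx.
have h2 : (2 + `|u|) ^+ 2 <= 8 + 2 * u ^+ 2.
  rewrite -[u ^+ 2]real_normK ?num_real//; have := sqr_ge0 (`|u| - 2); lra.
have c8 : 0 <= 8 + 2 / c by rewrite addr_ge0// divr_ge0// ltW.
apply: (le_trans h2); apply: le_trans (ler_wpM2l c8 h1).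
have -> : (8 + 2 / c) * (1 + c * u ^+ 2) = 8 + 2 * u ^+ 2 + 2 / c + 8 * (c * u ^+ 2).
  by field; rewrite gt_eqF.
rewrite -[leRHS]addrA lerDl addr_ge0//; first by rewrite divr_ge0// ltW.
by rewrite mulr_ge0// mulr_ge0 ?sqr_ge0// ltW.
Qed.

(** Half of the exponent pays for the polynomial: [1 + w <= (1 + 4 / c) * (1 + c / 4 * w)], and the
    square of the last factor is at most [expR (c / 2 * w)]. *)
Lemma expR_absorb (c : R) : 0 < c -> exists2 C : R, 0 < C &
  forall w : R, 0 <= w -> (1 + w) ^+ 2 * expR (- (c * w)) <= C * expR (- (c / 2 * w)).
Proof.
move=> c0; exists ((1 + 4 / c) ^+ 2) => [|w w0].
  by rewrite exprn_gt0// addr_gt0// divr_gt0.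
have -> : - (c * w) = c / 4 * w *- 2 - c / 2 * w by field.
rewrite expRD mulrA ler_pM2r ?expR_gt0// expRN ler_pdivrMr ?expR_gt0//.
rewrite mulr2n expRD -expr2 -exprMn ler_pXn2r ?nnegrE ?addr_ge0//; last first.
  by rewrite mulr_ge0 ?expR_ge0// addr_ge0// divr_ge0// ltW.
apply: (@le_trans _ _ ((1 + 4 / c) * (1 + c / 4 * w))); last first.
  by rewrite ler_wpM2l ?expR_ge1Dx// addr_ge0// divr_ge0// ltW.
have -> : (1 + 4 / c) * (1 + c / 4 * w) = 1 + w + (4 / c + c / 4 * w).
  by field; rewrite gt_eqF.
have c4 : 0 < c / 4 by rewrite divr_gt0.
have c5 : 0 < 4 / c by rewrite divr_gt0.
by rewrite lerDl addr_ge0 ?(ltW c5)// mulr_ge0// ltW.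
Qed.

(** Indices are natural numbers; the offset [L] centres the grid at the origin when
    [N = 2 L + 1]. *)
Definition grid_point (d N : nat) (delta : R) (L : nat) (k : {ffun 'I_d -> 'I_N}) : 'rV[R]_d :=
  \row_i (delta * ((k i)%:R - L%:R)).

(** Stands in for the Gaussian integral over [R^d]. Once the polynomial weight is absorbed into half
    of the exponent, the summand is a product over coordinates, and the grid sum is a product of [d]
    one-dimensional sums of step [delta / sqrt tau]; the condition [delta ^ 2 <= tau] keeps this
    step at most 1. *)
Lemma lattice_sum (d : nat) (c : R) : 0 < c -> exists2 C : R, 0 < C &
  forall (N L : nat) (delta tau : R) (x : 'rV[R]_d), 0 < delta -> 0 < tau -> delta ^+ 2 <= tau ->
  \sum_(k : {ffun 'I_d -> 'I_N}) (delta / Num.sqrt tau) ^+ d *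
     ((1 + normsq (x - grid_point delta L k) / tau) ^+ 2 *
      expR (- (c * (normsq (x - grid_point delta L k) / tau)))) <= C.
Proof.
move=> c0; have [C1 C10 absorb] := expR_absorb c0.
have [C2 C20 decay] := expR_decay (divr_gt0 c0 (ltr0Sn _ 1)).
exists (C1 * (C2 * 2) ^+ d) => [|N L delta tau x delta0 tau0 dt].
  by rewrite mulr_gt0// exprn_gt0// mulr_gt0.
set st := Num.sqrt tau; have st0 : 0 < st by rewrite sqrtr_gt0.
have stE : st ^+ 2 = tau by rewrite sqr_sqrtr// ltW.
set r := delta / st; have r0 : 0 < r by rewrite divr_gt0.
have r1 : r <= 1.
  by rewrite ler_pdivrMr// mul1r -(ler_pXn2r (ltn0Sn 1)) ?nnegrE ?(ltW st0) ?(ltW delta0)// stE.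
pose h (i : 'I_d) (k : 'I_N) : R := C2 * (r / (2 + `|(x 0 i + delta * L%:R) / st - r * k%:R|) ^+ 2).
apply: (@le_trans _ _ (\sum_(k : {ffun 'I_d -> 'I_N}) C1 * \prod_i h i (k i))).
  apply: ler_sum => k _; set w := normsq _ / tau.
  have w0 : 0 <= w by rewrite divr_ge0 ?normsq_ge0// ltW.
  apply: (@le_trans _ _ (r ^+ d * (C1 * expR (- (c / 2 * w))))).
    by rewrite ler_wpM2l ?exprn_ge0 ?(ltW r0)// absorb.
  rewrite mulrCA ler_pM2l//.
  have -> : - (c / 2 * w) = \sum_i - (c / 2 * ((x 0 i + delta * L%:R) / st - r * (k i)%:R) ^+ 2).
    rewrite /w /normsq mulr_suml mulr_sumr -sumrN; apply: eq_bigr => i _.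
    rewrite -stE !mxE /r; congr (- (_ * _)); field; rewrite gt_eqF//.
  rewrite expR_sum -[in r ^+ d](card_ord d) -prodr_const -big_split/=.
  apply: ler_prod => i _; rewrite mulr_ge0 ?expR_ge0 ?(ltW r0)//=.
  by rewrite /h [leRHS]mulrCA ler_pM2l.
rewrite -mulr_sumr ler_pM2l// -(bigA_distr_bigA h).
apply: (@le_trans _ _ (\prod_(i < d) (C2 * 2))); last first.
  by rewrite prodr_const card_ord.
apply: ler_prod => i _; apply/andP; split.
  by apply: sumr_ge0 => k _; rewrite /h mulr_ge0 ?divr_ge0 ?exprn_ge0 ?addr_ge0// ltW.
by rewrite /h -mulr_sumr ler_pM2l// lattice_sum1.
Qed.

End lattice.

(** * Derivatives of Gaussians *)

Lemma is_derive_line (R : realType) (V : normedModType R) (f : V -> R) (x v : V) (l : R) :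
  is_derive (0 : R) 1 (fun h => f (h *: v + x)) l -> is_derive x v f l.
Proof.
have E : (fun h : R => h^-1 *: (((fun h => f (h *: v + x)) \o shift 0) (h *: (1 : R)) - f (0 *: v + x))) =
         (fun h : R => h^-1 *: ((f \o shift x) (h *: v) - f x)).
  by apply/funext => h /=; rewrite scale0r add0r addr0 [h *: 1]mulr1.
move=> [d1 d2]; apply: DeriveDef.
  by move: d1; rewrite /derivable E.
by move: d2; rewrite /derive E.
Qed.

(** Along a coordinate line a Gaussian, and likewise its first partial derivative, is an affine
    function times the exponential of a quadratic polynomial; one formula thus yields the
    derivatives of both orders. *)
Lemma is_derive_affine_expR (R : realType) (l0 l1 k0 k1 k2 : R) :
  is_derive (0 : R) 1 (fun h => (l0 + l1 * h) * expR (k0 + k1 * h + k2 * h ^+ 2))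
    ((l1 + l0 * k1) * expR k0).
Proof.
have dl k m : is_derive (0 : R) 1 (cst k + m \*: id : R -> R) m.
  by apply: is_derive_eq; rewrite add0r /GRing.scale/= mulr1.
have d1 : is_derive (0 : R) 1 (fun h => l0 + l1 * h) l1 by exact: dl.
have d2 : is_derive (0 : R) 1 (fun h => k0 + k1 * h + k2 * h ^+ 2) k1.
  have d := dl k0 k1.
  have d' : is_derive (0 : R) 1 ((cst k0 + k1 \*: id : R -> R) + k2 \*: (id ^+ 2)) k1.
    apply: is_derive_eq; rewrite /GRing.scale/=; ring.
  exact: d'.
have d3 := @is_derive1_comp R expR _ 0 _ _ (is_derive_expR _) d2.
have d4 := is_derive_eq (is_deriveM d1 d3); apply: d4.
by rewrite /= !mulr0 expr0n/= mulr0 !addr0 /GRing.scale/=; ring.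
Qed.

Section continuous_arithmetic.
Context (R : realType) (T : topologicalType).
Implicit Types f g : T -> R.

Lemma continuous_addf f g :
  continuous f -> continuous g -> continuous (fun x => f x + g x).
Proof. by move=> cf cg x; apply: cvgD; [exact: cf|exact: cg]. Qed.

Lemma continuous_subf f g :
  continuous f -> continuous g -> continuous (fun x => f x - g x).
Proof. by move=> cf cg x; apply: cvgB; [exact: cf|exact: cg]. Qed.

Lemma continuous_mulf f g :
  continuous f -> continuous g -> continuous (fun x => f x * g x).
Proof. by move=> cf cg x; apply: cvgM; [exact: cf|exact: cg]. Qed.

Lemma continuous_cstf (c : R) : continuous (fun _ : T => c).
Proof. by move=> x; exact: cvg_cst. Qed.

Lemma continuous_sum (I : Type) (r : seq I) (F : I -> T -> R) :
  (forall i, continuous (F i)) -> continuous (fun x => \sum_(i <- r) F i x).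
Proof.
move=> cF x; elim: r => [|i r IH].
  by under eq_fun do rewrite big_nil; exact: cvg_cst.
by under eq_fun do rewrite big_cons; apply: cvgD; [exact: cF|exact: IH].
Qed.
End continuous_arithmetic.

Section gaussian.
Context (R : realType) (d : nat) (A : 'M[R]_d) (A_sym : A^T = A).

Lemma quad_line (h : R) (i : 'I_d) (z : 'rV[R]_d) :
  quad A (h *: delta_mx 0 i + z) =
  quad A z + 2 * (z *m A) 0 i * h + A i i * h ^+ 2.
Proof.
rewrite !quadE.
have -> : (h *: delta_mx 0 i + z)^T = h *: (delta_mx 0 i)^T + z^T by rewrite linearD linearZ.
rewrite !mulmxDr !mulmxDl -!scalemxAr -!scalemxAl.
have -> : delta_mx 0 i *m A *m z^T = z *m A *m (delta_mx 0 i)^T.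
  have tr1 (M : 'M[R]_1) : M^T = M by apply/matrixP => r s; rewrite mxE !ord1.
  by rewrite -[LHS]tr1 trmx_mul trmxK trmx_mul A_sym mulmxA.
have -> : (delta_mx 0 i *m A *m (delta_mx 0 i)^T : 'M[R]_1) = (A i i)%:M.
  rewrite [LHS]mx11_scalar -rowE trmx_delta -colE !mxE. by [].
have e : (z *m A *m (delta_mx 0 i : 'rV[R]_d)^T) 0 0 = (z *m A) 0 i.
  by rewrite trmx_delta -colE !mxE.
rewrite -e; move: (z *m A *m _) (z *m A *m z^T) => P Q.
by rewrite !mxE eqxx mulr1n; ring.
Qed.

Lemma mulmx_line (h : R) (i j : 'I_d) (z : 'rV[R]_d) :
  ((h *: delta_mx 0 i + z) *m A) 0 j = (z *m A) 0 j + A i j * h.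
Proof. by rewrite mulmxDl -scalemxAl -rowE !mxE addrC mulrC. Qed.

(** [T^(-d/2) * expR (- quad A (x - y) / (4 T))]: up to a constant factor, the heat kernel of the
    operator with coefficient matrix [A^-1]. The power is written with a logarithm so that
    everything sits in one exponent. *)
Definition gauss (y : 'rV[R]_d) (T : R) (x : 'rV[R]_d) : R :=
  expR (- (d%:R / 2 * ln T) - quad A (x - y) / (4 * T)).

Let slope (y : 'rV[R]_d) (x : 'rV[R]_d) i : R := ((x - y) *m A) 0 i.

Lemma is_derive_gauss y T x i : 0 < T ->
  is_derive x (delta_mx 0 i) (gauss y T) (- slope y x i / (2 * T) * gauss y T x).
Proof.
move=> T0; apply: is_derive_line.
pose z := x - y.
have -> : (fun h : R => gauss y T (h *: delta_mx 0 i + x)) = fun h => (1 + 0 * h) *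
    expR (- (d%:R / 2 * ln T) - quad A z / (4 * T) +
      (- slope y x i / (2 * T)) * h + (- A i i / (4 * T)) * h ^+ 2).
  apply/funext => h; rewrite mul0r addr0 mul1r /gauss -addrA quad_line -/z.
  by congr expR; rewrite /slope -/z; field; rewrite gt_eqF.
by apply: is_derive_eq (is_derive_affine_expR _ _ _ _ _) _; rewrite add0r mul1r.
Qed.

Lemma is_derive_slope_gauss y T x i j : 0 < T ->
  is_derive x (delta_mx 0 i) (fun x => - slope y x j / (2 * T) * gauss y T x)
   ((slope y x i * slope y x j / (4 * T ^+ 2) - A i j / (2 * T)) * gauss y T x).
Proof.
move=> T0; apply: is_derive_line.
pose z := x - y.
have -> : (fun h : R => - slope y (h *: delta_mx 0 i + x) j / (2 * T) * gauss y T (h *: delta_mx 0 i + x)) =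
  fun h => (- slope y x j / (2 * T) + (- A i j / (2 * T)) * h) *
    expR (- (d%:R / 2 * ln T) - quad A z / (4 * T) +
      (- slope y x i / (2 * T)) * h + (- A i i / (4 * T)) * h ^+ 2).
  apply/funext => h; rewrite /gauss /slope -addrA quad_line mulmx_line -/z.
  by congr (_ * expR _); field; rewrite gt_eqF.
apply: is_derive_eq (is_derive_affine_expR _ _ _ _ _) _.
by rewrite /gauss -/z; congr (_ * _); field; rewrite gt_eqF.
Qed.

Lemma is_derive_time_gauss (y : 'rV[R]_d) (T : R) (x : 'rV[R]_d) : 0 < T ->
  is_derive T 1 (fun T : R => gauss y T x)
   ((quad A (x - y) / (4 * T ^+ 2) - d%:R / (2 * T)) * gauss y T x).
Proof.
move=> T0; set q := quad A (x - y).
have d1 : is_derive T 1 (fun T : R => - (d%:R / 2) * ln T + - (q / 4) * T^-1)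
    (q / (4 * T ^+ 2) - d%:R / (2 * T)).
  have h1 := is_deriveZ (- (d%:R / 2)) (is_derive1_ln T0).
  have h2 := is_deriveZ (- (q / 4)) (is_deriveV (lt0r_neq0 T0) (is_derive_id T 1)).
  apply: is_derive_eq (is_deriveD h1 h2) _.
  by rewrite /GRing.scale/=; field; rewrite gt_eqF.
have -> : (fun T => gauss y T x) = expR \o (fun T : R => - (d%:R / 2) * ln T + - (q / 4) * T^-1).
  apply/funext => S /=; rewrite /gauss -/q; congr expR.
  by rewrite invfM; ring.
apply: is_derive_eq (is_derive1_comp (is_derive_expR _) d1) _.
rewrite mulrC; congr (_ * _); rewrite /gauss -/q; congr expR.
by rewrite invfM; ring.
Qed.

Lemma partial_gauss y T i : 0 < T ->
  partial i (gauss y T) = fun x => - slope y x i / (2 * T) * gauss y T x.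
Proof. by move=> T0; apply/funext => x; exact: (@derive_val _ _ _ _ _ _ _ (is_derive_gauss y x i T0)). Qed.

Lemma partial_partial_gauss y T i j : 0 < T ->
  partial i (partial j (gauss y T)) =
  fun x => (slope y x i * slope y x j / (4 * T ^+ 2) - A i j / (2 * T)) * gauss y T x.
Proof.
move=> T0; rewrite partial_gauss//; apply/funext => x.
exact: (@derive_val _ _ _ _ _ _ _ (is_derive_slope_gauss y x i j T0)).
Qed.

Let coordB_continuous (y : 'rV[R]_d) i : continuous (fun x : 'rV[R]_d => (x - y) 0 i).
Proof.
have -> : (fun x : 'rV[R]_d => (x - y) 0 i) = (fun x => x 0 i - y 0 i).
  by apply/funext => x; rewrite !mxE.
by apply: continuous_subf; [exact: coord_continuous|exact: continuous_cstf].
Qed.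

Lemma slope_continuous y i : continuous (fun x => slope y x i).
Proof.
rewrite /slope; under eq_fun => z do rewrite mxE.
apply: continuous_sum => k.
by apply: continuous_mulf; [exact: coordB_continuous|exact: continuous_cstf].
Qed.

Lemma quad_continuous (y : 'rV[R]_d) : continuous (fun x : 'rV[R]_d => quad A (x - y)).
Proof.
rewrite /quad; apply: continuous_sum => i; apply: continuous_sum => j.
apply: continuous_mulf; last exact: coordB_continuous.
by apply: continuous_mulf; [exact: continuous_cstf|exact: coordB_continuous].
Qed.

Lemma gauss_continuous y T : continuous (gauss y T).
Proof.
move=> x; apply: continuous_comp; last exact: continuous_expR.
apply: continuous_subf; first exact: continuous_cstf.
by apply: continuous_mulf; [exact: quad_continuous|exact: continuous_cstf].
Qed.

Lemma gauss_C2 y T : 0 < T -> C2 (gauss y T).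
Proof.
move=> T0; have cG := @gauss_continuous y T.
have cD i : continuous (partial i (gauss y T)).
  rewrite partial_gauss//; apply: continuous_mulf => //.
  apply: continuous_mulf; last exact: continuous_cstf.
  under eq_fun do rewrite -mulN1r.
  by apply: continuous_mulf; [exact: continuous_cstf|exact: slope_continuous].
split; first split => // i; first split => // x.
  by have [] := is_derive_gauss y x i T0.
move=> i; split => // j; split => [x|].
  by rewrite partial_gauss//; have [] := is_derive_slope_gauss y x j i T0.
rewrite partial_partial_gauss//; apply: continuous_mulf => //.
apply: continuous_subf; last exact: continuous_cstf.
by apply: continuous_mulf; [apply: continuous_mulf; exact: slope_continuous|exact: continuous_cstf].
Qed.

End gaussian.

(** * Increments of a solution of the martingale problem *)

Section bounded_integrals.
Context disp (T : measurableType disp) (R : realType) (P : probability T R).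
Implicit Types (A : set T) (f g : T -> R).

Lemma bounded_integrable A f (C : R) : measurable A -> measurable_fun setT f ->
  (forall x, `|f x| <= C) -> P.-integrable A (EFin \o f).
Proof.
move=> mA mf fC; apply: (@measurable_bounded_integrable _ _ _ P) => //.
- exact: le_lt_trans (probability_le1 P mA) (ltry _).
- exact: measurable_funTS.
- exists C; split; first exact: num_real.
  by move=> M CM x _; exact: le_trans (fC x) (ltW CM).
Qed.

Lemma bounded_Rintegral_le A f (C : R) : measurable A -> measurable_fun setT f ->
  (forall x, `|f x| <= C) -> `|\int[P]_(x in A) f x| <= C.
Proof.
move=> mA mf fC.
have C0 : 0 <= C by exact: le_trans (fC point).
apply: le_trans (le_normr_Rintegral mA (bounded_integrable mA mf fC)) _.
apply: (@le_trans _ _ (\int[P]_(x in A) C)).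
  apply: le_Rintegral => //.
  - by apply: integrable_norm; exact: bounded_integrable mA mf fC.
  - by apply: (@bounded_integrable _ _ C) => // x; rewrite ger0_norm.
rewrite Rintegral_cst// -[leRHS]mulr1 ler_wpM2l//.
by rewrite -lee_fin fineK ?fin_num_measure// probability_le1.
Qed.

Lemma bounded_Rintegral_cvg A (f_ : nat -> T -> R) f (C : R) : measurable A ->
  (forall n, measurable_fun setT (f_ n)) -> (forall n x, `|f_ n x| <= C) ->
  (forall x, f_ n x @[n --> \oo] --> f x) ->
  \int[P]_(x in A) f_ n x @[n --> \oo] --> \int[P]_(x in A) f x.
Proof.
move=> mA mf fC ff.
have fEcvg x : (f_ n x)%:E @[n --> \oo] --> (f x)%:E.
  by apply: cvg_EFin; [exact: nearW|exact: ff].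
have mlim : measurable_fun A f.
  apply/measurable_EFinP.
  apply: (@emeasurable_fun_cvg _ _ _ _ (fun n => EFin \o f_ n)) => [n|x _].
    by apply/measurable_EFinP; exact: measurable_funTS.
  exact: fEcvg.
have intC : P.-integrable A (cst C%:E).
  exact: (@bounded_integrable A (cst C) `|C|).
have [intf _] := @dominated_convergence _ _ _ P A mA (fun n => EFin \o f_ n) (EFin \o f) (cst C%:E)
  (fun n => (measurable_EFinP A (f_ n)).2 (measurable_funTS (mf n))) ((measurable_EFinP A f).2 mlim)
  (aeW _ (fun x _ => fEcvg x)) intC (aeW _ (fun x n _ => fC n x)).
rewrite -[X in _ --> X](fineK (integrable_fin_num mA intf)).
by move/fine_cvg.
Qed.
End bounded_integrals.

(** Covers both orders of [s] and [r], for two-sided difference quotients; the bound on [xi - s]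
    makes [xi] converge to [s] along with [r]. *)
Lemma mvt_between (R : realType) (f df : R -> R) (s r : R) :
  (forall x, Num.min s r <= x <= Num.max s r -> is_derive x 1 f (df x)) ->
  exists xi, [/\ Num.min s r <= xi <= Num.max s r, `|xi - s| <= `|r - s| &
    f r - f s = df xi * (r - s)].
Proof.
wlog sr : s r / s <= r => [wlg fd|].
  have [sr|rs] := orP (le_total s r); first exact: (wlg s r sr fd).
  have [|xi [xi1 xi2 xi3]] := wlg r s rs; first by rewrite minC maxC.
  exists xi; split; first by rewrite minC maxC.
    move: xi1; rewrite (min_l rs) (max_r rs) => /andP[rx xs].
    by rewrite !ler0_norm ?subr_le0//; lra.
  by rewrite -[LHS]opprB xi3 -mulrN opprB.
rewrite (min_l sr) (max_r sr) => fd.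
have [||xi] := @MVT_segment R f df s r sr.
- by move=> x; rewrite in_itv/= => /andP[/ltW sx /ltW xr]; apply: fd; rewrite sx xr.
- apply: derivable_within_continuous => x; rewrite in_itv/= => xsr.
  by have [] := fd x xsr.
- rewrite in_itv/= => /andP[sx xr] E; exists xi; rewrite sx xr; split => //.
  by rewrite !ger0_norm ?subr_ge0// lerD2r.
Qed.

(** * Paths on the whole time line and time integrals along them *)

Definition clipped_path (R : realType) (d : nat) (t : R) (omega : Omega R d) :=
  coord_process (Num.max t 0) omega.

Lemma clipped_path_cvg (R : realType) (d : nat) (omega : Omega R d) (u : nat -> R) (s : R) :
  u n @[n --> \oo] --> s -> clipped_path (u n) omega @[n --> \oo] --> clipped_path s omega.
Proof.
move=> us; apply: (@cvg_comp _ _ _ u (fun t => clipped_path t omega) _ _ _ us).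
exact: coord_process_continuous.
Qed.

Lemma measurable_clipped_path (R : realType) (d : nat) (t : R) (f : 'rV[R]_d -> R) :
  continuous f ->
  measurable_fun [set: Omega R d] (fun omega => f (clipped_path t omega)).
Proof. by move=> cf; apply: measurable_coord_process => //; rewrite le_max lexx orbT. Qed.

Section path_integral.
Context (R : realType) (d : nat) (g : 'rV[R]_d -> R) (g_continuous : continuous g).
Context (omega : Omega R d).

Definition path_integral (t : R) : R :=
  \int[@lebesgue_measure R]_(s in `[0, t]) g (coord_process s omega).

Let path_continuous : continuous (fun s => g (clipped_path s omega)).
Proof.
by move=> s; apply: continuous_comp; [exact: coord_process_continuous|exact: g_continuous].
Qed.

Lemma is_derive_path_integral (s : R) : 0 < s ->
  is_derive s 1 path_integral (g (clipped_path s omega)).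
Proof.
move=> s0.
have E : path_integral = fun t => \int[@lebesgue_measure R]_(s in `[0, t]) g (clipped_path s omega).
  apply/funext => t; apply: eq_Rintegral => r; rewrite inE/= in_itv/= => /andP[r0 _].
  by rewrite /clipped_path max_l.
(* The end point [s + 1] leaves [s] in the interior of the interval, so the derivative is
   two-sided. *)
have [||||d1 d2] := @continuous_FTC1_closed R (fun t => g (clipped_path t omega)) 0 s (s + 1).
- by rewrite ltrDl.
- apply: continuous_compact_integrable; first exact: segment_compact.
  exact: continuous_subspaceT.
- by [].
- exact: path_continuous.
by rewrite E; apply: DeriveDef; rewrite -?derive1E.
Qed.

Lemma path_integral_increment (s r : R) : 0 < s -> 0 < r ->
  exists xi, `|xi - s| <= `|r - s| /\
    path_integral r - path_integral s = g (clipped_path xi omega) * (r - s).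
Proof.
move=> s0 r0.
have [x /andP[mx _]|xi [_ xi1 xi2]] :=
  @mvt_between R path_integral (fun x => g (clipped_path x omega)) s r.
  by apply: is_derive_path_integral; apply: lt_le_trans mx; rewrite lt_min s0.
by exists xi.
Qed.
End path_integral.

Lemma generator_continuous (R : realType) (d : nat) (a : 'rV[R]_d -> 'M[R]_d) (f : 'rV[R]_d -> R) :
  (forall i j, continuous (fun x => a x i j)) -> C2 f -> continuous (generator a f).
Proof.
move=> ca [_ cf]; apply: continuous_sum => i; apply: continuous_sum => j.
apply: continuous_mulf; first exact: ca.
by have [_ /(_ i)[]] := cf j.
Qed.

Lemma condexp_Rintegral (disp : measure_display) (T : measurableType disp)
    (R : realType) (P : probability T R) (G : set (set T)) (Z Y : T -> R) (A : set T) :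
  is_condexp P G Z Y -> G A -> \int[P]_(x in A) Z x = \int[P]_(x in A) Y x.
Proof. by move=> [_ _ E] GA; rewrite /Rintegral E. Qed.

(** * Expectations over past events and their time derivatives *)

Section martingale_increment.
Context (R : realType) (d : nat) (a : 'rV[R]_d -> 'M[R]_d).
Hypothesis a_continuous : forall i j, continuous (fun x => a x i j).
Context (P : probability (Omega R d) R).
Hypothesis P_martingale : forall f : 'rV[R]_d -> R, Cb2 f ->
  martingale P (@coord_filtration R d)
    (fun t omega =>
       f (coord_process t omega) - f (coord_process 0 omega) -
       (\int[@lebesgue_measure R]_(s in `[0, t]) generator a f (coord_process s omega))%R).

(** Restriction to an event [A] of the past plays the role of conditioning on it, without
    normalization. *)
Definition ev (A : set (Omega R d)) (t : R) (h : 'rV[R]_d -> R) : R :=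
  \int[P]_(omega in A) h (clipped_path t omega).

Lemma Cb2_bound (f : 'rV[R]_d -> R) : Cb2 f -> exists C, forall x, `|f x| <= C.
Proof.
move=> [_ [M [_ fM]] _ _]; exists (M + 1) => x; apply: fM => //.
by rewrite ltrDl.
Qed.

Lemma Cb2_continuous (f : 'rV[R]_d -> R) : Cb2 f -> continuous f.
Proof. by move=> [[[]]]. Qed.

Let mart (f : 'rV[R]_d -> R) (t : R) (omega : Omega R d) : R :=
  f (coord_process t omega) - f (coord_process 0 omega) - path_integral (generator a f) omega t.

Let mart_integrable f t (A : set (Omega R d)) : Cb2 f -> 0 <= t -> measurable A ->
  P.-integrable A (EFin \o mart f t).
Proof.
move=> f2 t0 mA; have [_ /(_ t t0) h _] := P_martingale f2.
by apply: integrableS h.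
Qed.

(** The integral is recovered from the martingale and two values of [f] along the path;
    measurability of the martingale at each time is part of its definition. *)
Lemma measurable_path_integral f t : Cb2 f -> 0 <= t ->
  measurable_fun setT (fun omega : Omega R d => path_integral (generator a f) omega t).
Proof.
move=> f2 t0; have [/(_ t t0) h _ _] := P_martingale f2.
have -> : (fun omega : Omega R d => path_integral (generator a f) omega t) = (fun omega =>
    f (coord_process t omega) - f (coord_process 0 omega) - mart f t omega).
  by apply/funext => omega; rewrite /mart opprB addrC subrK.
have mm : measurable_fun setT (mart f t).
  by move=> _ B mB; rewrite setTI; apply: (coord_filtration_measurable t0); exact: h.
apply: measurable_funB => //; apply: measurable_funB.
  by apply: measurable_coord_process => //; exact: Cb2_continuous.
by apply: measurable_coord_process => //; exact: Cb2_continuous.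
Qed.

Lemma ev_integrable f C t (A : set (Omega R d)) : measurable A -> continuous f ->
  (forall x, `|f x| <= C) ->
  P.-integrable A (EFin \o (fun omega : Omega R d => f (clipped_path t omega))).
Proof.
move=> mA cf fC.
by have := bounded_integrable P mA (measurable_clipped_path t cf) (fun omega => fC (clipped_path t omega)).
Qed.

(** As [A] belongs to the past of [s0], the martingale has the same integral over [A] at the times
    [s0], [s] and [r]; only the path integral remains of the increment. *)
Lemma ev_increment f (A : set (Omega R d)) (s0 s r : R) : Cb2 f -> 0 <= s0 ->
  coord_filtration s0 A -> s0 <= s -> s0 <= r ->
  ev A r f - ev A s f =
  \int[P]_(omega in A)
    (path_integral (generator a f) omega r - path_integral (generator a f) omega s).
Proof.
move=> f2 s00 FA s0s s0r; have mA := coord_filtration_measurable s00 FA.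
have s_ge0 := le_trans s00 s0s; have r_ge0 := le_trans s00 s0r.
have E t : s0 <= t -> \int[P]_(omega in A) mart f t omega = \int[P]_(omega in A) mart f s0 omega.
  move=> s0t; have [_ _ /(_ s0 t s00 s0t) h] := P_martingale f2.
  exact: (condexp_Rintegral h FA).
have [C fC] := Cb2_bound f2; have cf := Cb2_continuous f2.
have If t := ev_integrable t mA cf fC.
have Im t (t0 : 0 <= t) := mart_integrable f2 t0 mA.
transitivity (\int[P]_(omega in A) ((f (clipped_path r omega) - f (clipped_path s omega)) -
    (mart f r omega - mart f s omega))); last first.
  apply: eq_Rintegral => omega _; rewrite /clipped_path !max_l// /mart.
  by move: (f _) (f _) (f _) (path_integral _ _ _) (path_integral _ _ _) => *; ring.
rewrite RintegralB//; last 2 first.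
- exact: (integrableB mA (If r) (If s)).
- exact: (integrableB mA (Im _ r_ge0) (Im _ s_ge0)).
rewrite (RintegralB mA (If r) (If s)) (RintegralB mA (Im _ r_ge0) (Im _ s_ge0)).
by rewrite !E// subrr subr0.
Qed.

Section time_derivative.
Context (G G' : R -> 'rV[R]_d -> R) (s0 t1 s C : R) (A : set (Omega R d)).
Hypotheses (s0_ge0 : 0 <= s0) (FA : coord_filtration s0 A) (ss : s0 < s < t1).
Hypothesis G2 : forall r, s0 < r < t1 -> Cb2 (G r).
Hypothesis dG : forall r x, s0 < r < t1 -> is_derive r 1 (fun r => G r x) (G' r x).
Hypothesis G'C : forall r x, s0 < r < t1 -> `|G' r x| <= C.
Hypothesis G'_cvg : forall (u : nat -> R) (x : nat -> 'rV[R]_d) x0,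
  (forall n, s0 < u n < t1) -> u n @[n --> \oo] --> s -> x n @[n --> \oo] --> x0 ->
  G' (u n) (x n) @[n --> \oo] --> G' s x0.
Hypothesis LG_bounded : forall x, `|generator a (G s) x| <= C.

Let phi r := ev A r (G r).
Let l := ev A s (fun x => generator a (G s) x + G' s x).

(** The increment of [phi] splits into the motion of the path under the fixed function [G s], which
    [ev_increment] turns into a path integral, and the change of the function at the fixed position
    [X_r]. The mean value theorem makes each quotient a value at an intermediate time, path by path,
    and bounded convergence concludes. *)
Let quotient_cvg (r : nat -> R) : (forall n, s0 < r n < t1) -> (forall n, r n != s) ->
  r n @[n --> \oo] --> s -> (r n - s)^-1 * (phi (r n) - phi s) @[n --> \oo] --> l.
Proof.
move=> rI rs r_cvg; have mA := coord_filtration_measurable s0_ge0 FA.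
have s_gt0 : 0 < s by apply: le_lt_trans s0_ge0 _; case/andP: ss.
have r_gt0 n : 0 < r n by apply: le_lt_trans s0_ge0 _; case/andP: (rI n).
pose g := generator a (G s).
have cg : continuous g by apply: generator_continuous => //; have [] := G2 ss.
pose I t (omega : Omega R d) := path_integral g omega t.
pose D n (omega : Omega R d) : R := (r n - s)^-1 * ((I (r n) omega - I s omega) +
  (G (r n) (clipped_path (r n) omega) - G s (clipped_path (r n) omega))).
(* [p.1] is the intermediate time on the path, [p.2] the intermediate parameter of [G]. *)
have Dxi n omega : exists p : R * R, [/\ `|p.1 - s| <= `|r n - s|, `|p.2 - s| <= `|r n - s|,
    s0 < p.2 < t1 & D n omega = g (clipped_path p.1 omega) + G' p.2 (clipped_path (r n) omega)].
  have [xi [xi1 xi2]] := path_integral_increment cg omega s_gt0 (r_gt0 n).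
  have [x sxr|zeta [zeta0 zeta1 zeta2]] :=
    @mvt_between R (G^~ (clipped_path (r n) omega)) (G'^~ (clipped_path (r n) omega)) s (r n).
    apply: dG; case/andP: sxr => mx xM; case/andP: ss => h1 h2; case/andP: (rI n) => h3 h4.
    by rewrite (lt_le_trans _ mx) ?lt_min ?h1//= (le_lt_trans xM)// gt_max h2.
  have z : s0 < zeta < t1.
    case/andP: zeta0 => mx xM; case/andP: ss => h1 h2; case/andP: (rI n) => h3 h4.
    by rewrite (lt_le_trans _ mx) ?lt_min ?h1//= (le_lt_trans xM)// gt_max h2.
  exists (xi, zeta); split => //=; rewrite /D xi2 zeta2 -mulrDl mulrC mulfK//.
  by rewrite subr_eq0.
have mD n : measurable_fun setT (D n).
  apply: measurable_funM; first exact: measurable_cst.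
  apply: measurable_funD; apply: measurable_funB.
  - exact: (measurable_path_integral (G2 ss) (ltW (r_gt0 n))).
  - exact: (measurable_path_integral (G2 ss) (ltW s_gt0)).
  - exact: (measurable_clipped_path (r n) (Cb2_continuous (G2 (rI n)))).
  - exact: (measurable_clipped_path (r n) (Cb2_continuous (G2 ss))).
have DC n omega : `|D n omega| <= C + C.
  have [[xi zeta] /= [_ _ z ->]] := Dxi n omega.
  by rewrite (le_trans (ler_normD _ _))// lerD// G'C.
have D_cvg omega : D n omega @[n --> \oo] --> g (clipped_path s omega) + G' s (clipped_path s omega).
  have /choice[p pP] := fun n => Dxi n omega.
  have p_cvg (q : nat -> R) : (forall n, `|q n - s| <= `|r n - s|) -> q n @[n --> \oo] --> s.
    move=> qr; apply/cvgrPdist_le => e e0.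
    have /cvgrPdist_le/(_ e e0) := r_cvg; apply: filterS => n re.
    by rewrite distrC (le_trans (qr n))// distrC.
  have -> : (fun n => D n omega) = (fun n => g (clipped_path (p n).1 omega) +
      G' (p n).2 (clipped_path (r n) omega)).
    by apply/funext => n; have [] := pP n.
  apply: cvgD.
    apply: (@cvg_comp _ _ _ (fun n => clipped_path (p n).1 omega) g _ _ _ _ (cg _)).
    by apply: clipped_path_cvg; apply: p_cvg => n; have [] := pP n.
  apply: G'_cvg; first by move=> n; have [] := pP n.
    by apply: p_cvg => n; have [] := pP n.
  exact: clipped_path_cvg.
have -> : (fun n => (r n - s)^-1 * (phi (r n) - phi s)) =
    (fun n => \int[P]_(omega in A) D n omega); last first.
  exact: (bounded_Rintegral_cvg mA mD DC D_cvg).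
apply/funext => n; rewrite /phi.
have sr0 : s0 <= s by case/andP: ss => /ltW.
have rr0 : s0 <= r n by case/andP: (rI n) => /ltW.
have [C1 GC1] := Cb2_bound (G2 ss); have [C2 GC2] := Cb2_bound (G2 (rI n)).
have i1 := ev_integrable (r n) mA (Cb2_continuous (G2 ss)) GC1.
have i2 := ev_integrable (r n) mA (Cb2_continuous (G2 (rI n))) GC2.
have i3 : P.-integrable A (EFin \o (fun omega => I (r n) omega - I s omega)).
  apply: (@bounded_integrable _ _ _ P A _ (C * `|r n - s|) mA).
    apply: measurable_funB; first exact: (measurable_path_integral (G2 ss) (ltW (r_gt0 n))).
    exact: (measurable_path_integral (G2 ss) (ltW s_gt0)).
  move=> omega; have [xi [_ xi2]] := path_integral_increment cg omega s_gt0 (r_gt0 n).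
  by rewrite xi2 normrM ler_wpM2r.
have i4 := integrableB mA i2 i1.
rewrite /D RintegralZl//; last exact: (integrableD mA i3 i4).
rewrite (RintegralD mA i3 i4) (RintegralB mA i2 i1).
rewrite -(ev_increment (G2 ss) s0_ge0 FA sr0 rr0) /ev.
by congr (_ * _); rewrite [RHS]addrC addrA subrK.
Qed.

(** Limits of difference quotients are taken along sequences, as bounded convergence demands. *)
Lemma is_derive_ev : is_derive s 1 phi l.
Proof.
have cv : h^-1 *: ((phi \o shift s) (h *: (1 : R)) - phi s) @[h --> 0^'] --> l.
  apply/cvgr_dnbhsP => u [u0 u_cvg].
  have us_cvg : u n + s @[n --> \oo] --> s.
    by rewrite -[X in _ --> X]add0r; apply: cvgD => //; exact: cvg_cst.
  have [N _ HN] : \forall n \near \oo, s0 < u n + s < t1.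
    case/andP: ss => h1 h2; near=> n; apply/andP; split; near: n.
      exact: (cvgr_gt s us_cvg).
    exact: (cvgr_lt s us_cvg).
  (* Dropping the first [N] terms puts every time into the open interval, where [quotient_cvg]
     applies. *)
  rewrite -(cvg_shiftn N).
  have Q := @quotient_cvg (fun n => u (n + N)%N + s).
  apply: (cvg_trans _ (Q _ _ _)).
  - by apply: near_eq_cvg; apply: nearW => n /=; rewrite addrK [_%:A]mulr1.
  - by move=> n; apply: HN => /=; exact: leq_addl.
  - by move=> n; rewrite -subr_eq0 addrK.
  - by rewrite (cvg_shiftn N (fun n => u n + s)).
apply: DeriveDef; first by apply/cvg_ex; exists l.
exact/cvg_lim.
Unshelve. all: by end_near. Qed.
End time_derivative.

End martingale_increment.

(** * Gaussians with frozen coefficients *)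

Lemma sqrt_expR_ln (R : realType) (T : R) : 0 < T -> Num.sqrt T = expR (ln T / 2).
Proof.
move=> T0; rewrite -[RHS]ger0_norm ?expR_ge0// -sqrtr_sqr; congr Num.sqrt.
by rewrite -expRM_natl mulrC divfK// lnK.
Qed.

Lemma bounded_fun_le (R : realType) (T : Type) (f : T -> R) (C : R) :
  (forall x, `|f x| <= C) -> bounded_fun f.
Proof.
move=> fC; exists C; split; first exact: num_real.
by move=> M CM x _; exact: le_trans (fC x) (ltW CM).
Qed.

Lemma holder_continuous_at (R : realType) (T : topologicalType) (f h : T -> R)
    (y : T) (K beta : R) : 0 < K -> 0 < beta -> continuous h -> h y = 0 ->
  (forall x, 0 <= h x) -> (forall x, `|f x - f y| <= K * h x `^ beta) ->
  f x @[x --> y] --> f y.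
Proof.
move=> K0 beta0 ch hy h0 fh; apply/cvgrPdist_le => e e0.
pose delta := (e / K) `^ beta^-1.
have eK : 0 < e / K by rewrite divr_gt0.
have delta0 : 0 < delta by exact: powR_gt0.
have hyd : h y < delta by rewrite hy.
apply: filterS (cvgr_lt _ (ch y) _ hyd) => x xd.
rewrite distrC (le_trans (fh x))// mulrC -ler_pdivlMr//.
have -> : e / K = delta `^ beta by rewrite /delta -powRrM mulVf ?gt_eqF// powRr1 ?(ltW eK).
by apply: ge0_ler_powR; rewrite ?nnegrE ?h0 ?(ltW beta0) ?(ltW delta0) ?(ltW xd).
Qed.

Section frozen_gaussian.
Context (R : realType) (d : nat) (a : 'rV[R]_d -> 'M[R]_d) (Lm LM K beta : R).
Hypothesis a_sym : forall x, (a x)^T = a x.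
Hypotheses (Lm0 : 0 < Lm) (LmM : Lm <= LM).
Hypothesis a_ell : forall x z, Lm * normsq z <= quad (a x) z /\ quad (a x) z <= LM * normsq z.
Hypotheses (K0 : 0 < K) (beta0 : 0 < beta) (beta1 : beta <= 1).
Hypothesis a_holder : forall i j x y, `|a x i j - a y i j| <= K * normsq (x - y) `^ beta.

Let LM0 : 0 < LM. Proof. exact: lt_le_trans LmM. Qed.
Let c := 1 / (4 * LM).

(** This is [G_y]: the centre of the Gaussian is also the point at which the coefficients are
    frozen. *)
Definition frozen (y : 'rV[R]_d) := gauss (invmx (a y)) y.

(** The factor by which [frozen y T x] is multiplied in its second partial derivatives. *)
Definition hess (y : 'rV[R]_d) (T : R) (x : 'rV[R]_d) i j : R :=
  ((x - y) *m invmx (a y)) 0 i * ((x - y) *m invmx (a y)) 0 j / (4 * T ^+ 2) -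
  invmx (a y) i j / (2 * T).

Let inv_sym y : (invmx (a y))^T = invmx (a y). Proof. exact: invmx_sym. Qed.

Lemma frozen_ge0 y T x : 0 <= frozen y T x. Proof. exact: expR_ge0. Qed.

Lemma frozen_le y T x : 0 < T ->
  frozen y T x <= (Num.sqrt T ^+ d)^-1 * expR (- (c * (normsq (x - y) / T))).
Proof.
move=> T0; rewrite /frozen /gauss expRD ler_pM ?expR_ge0//.
  by rewrite sqrt_expR_ln// -expRM_natl -expRN ler_expR le_eqVlt mulrA mulrAC eqxx.
rewrite ler_expR lerN2; have := quad_inv_ge (a_sym y) Lm0 LmM (a_ell y) (x - y).
rewrite ler_pdivlMr ?mulr_gt0// => h.
have -> : c * (normsq (x - y) / T) * (4 * T) = normsq (x - y) / LM by rewrite /c; field; rewrite !gt_eqF.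
exact: h.
Qed.

Lemma frozen_ge y T x : 0 < T ->
  (Num.sqrt T ^+ d)^-1 * expR (- (normsq (x - y) / (4 * Lm * T))) <= frozen y T x.
Proof.
move=> T0; rewrite /frozen /gauss expRD ler_pM ?expR_ge0 ?invr_ge0 ?exprn_ge0 ?sqrtr_ge0//.
  by rewrite sqrt_expR_ln// -expRM_natl -expRN ler_expR le_eqVlt mulrA mulrAC eqxx.
rewrite ler_expR lerN2; have := quad_inv_le Lm0 (a_ell y) (x - y) => h.
rewrite ler_pdivrMr ?mulr_gt0// (le_trans h)// le_eqVlt; apply/orP; left; apply/eqP.
by field; rewrite !gt_eqF.
Qed.

(** The first summand comes from the product of two coordinates of [(x - y) a(y)^-1], the second
    from an entry of [a(y)^-1]. *)
Let Ch : R := 1 / (4 * Lm ^+ 2) + 1 / (2 * Lm).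

Let Ch_gt0 : 0 < Ch. Proof. by rewrite addr_gt0// divr_gt0// mulr_gt0// exprn_gt0. Qed.

Let coord2 y x i : (((x - y) *m invmx (a y)) 0 i) ^+ 2 <= normsq (x - y) / Lm ^+ 2.
Proof. exact: (mul_inv_coord_le Lm0 (a_ell y)). Qed.

Lemma hess_le y T x i j : 0 < T ->
  `|hess y T x i j| <= Ch / T * (1 + normsq (x - y) / T).
Proof.
move=> T0; rewrite /hess; have := coord2 y x i; have := coord2 y x j.
have := invmx_entry_le Lm0 (a_ell y) i j.
set u := _ 0 i; set v := _ 0 j; set n := normsq _; set m := _ i j => m1 v1 u1.
have n0 : 0 <= n by exact: normsq_ge0.
have uv : `|u * v| <= n / Lm ^+ 2.
  rewrite ler_norml; have := sqr_ge0 (u - v); have := sqr_ge0 (u + v); nra.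
apply: (le_trans (ler_normB _ _)).
apply: (@le_trans _ _ (n / Lm ^+ 2 / (4 * T ^+ 2) + Lm^-1 / (2 * T))).
  have T2 : 0 < 4 * T ^+ 2 by rewrite mulr_gt0// exprn_gt0.
  have T1 : 0 < 2 * T by rewrite mulr_gt0.
  by rewrite !normrM !normfV (gtr0_norm T2) (gtr0_norm T1) -normrM lerD// ler_pM2r ?invr_gt0.
have -> : Ch / T * (1 + n / T) = n / Lm ^+ 2 / (4 * T ^+ 2) + Lm^-1 / (2 * T) +
   (1 / (4 * Lm ^+ 2 * T) + n / (2 * Lm * T ^+ 2)).
  by rewrite /Ch; field; rewrite !gt_eqF.
by rewrite lerDl addr_ge0// divr_ge0// ltW// !mulr_gt0// exprn_gt0.
Qed.

Lemma partial2_frozen y T i j : 0 < T ->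
  partial i (partial j (frozen y T)) = fun x => hess y T x i j * frozen y T x.
Proof. by move=> T0; rewrite /frozen partial_partial_gauss. Qed.

(** This is the heat equation for [G_y]: contracted with [a y], the product of coordinates gives the
    quadratic form of the inverse, and the inverse itself gives the trace [d] of the identity, so
    [L^y G_y] equals the time derivative. *)
Lemma hess_trace y T x : 0 < T ->
  \sum_(i < d) \sum_(j < d) a y i j * hess y T x i j =
  quad (invmx (a y)) (x - y) / (4 * T ^+ 2) - d%:R / (2 * T).
Proof.
move=> T0; set z := x - y.
have ua : a y \in unitmx := elliptic_unitmx Lm0 (a_ell y).
have -> : quad (invmx (a y)) z = \sum_(i < d) \sum_(j < d) a y i j * ((z *m invmx (a y)) 0 i * (z *m invmx (a y)) 0 j).
  transitivity (quad (a y) (z *m invmx (a y))).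
    by rewrite !quadE mulmxKV// trmx_mul inv_sym mulmxA.
  by apply: eq_bigr => i _; apply: eq_bigr => j _; rewrite mulrA.
have -> : d%:R = \sum_(i < d) \sum_(j < d) a y i j * invmx (a y) i j.
  transitivity (\tr (a y *m invmx (a y))).
    by rewrite mulmxV// mxtrace1.
  apply: eq_bigr => i _; rewrite mxE; apply: eq_bigr => j _.
  by rewrite -[in LHS]inv_sym mxE.
rewrite !mulr_suml -sumrB; apply: eq_bigr => i _.
rewrite !mulr_suml -sumrB; apply: eq_bigr => j _.
by rewrite /hess -/z mulrBr !mulrA.
Qed.

(** [(L - L^y) G_y], the error made by freezing the coefficients. *)
Definition kern (y : 'rV[R]_d) (T : R) (x : 'rV[R]_d) : R :=
  (\sum_(i < d) \sum_(j < d) (a x i j - a y i j) * hess y T x i j) * frozen y T x.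

Definition frozen_dt (y : 'rV[R]_d) (T : R) (x : 'rV[R]_d) : R :=
  (quad (invmx (a y)) (x - y) / (4 * T ^+ 2) - d%:R / (2 * T)) * frozen y T x.

Lemma generator_frozen y T x : 0 < T ->
  generator a (frozen y T) x = frozen_dt y T x + kern y T x.
Proof.
move=> T0; rewrite /frozen_dt -hess_trace// /kern -mulrDl -big_split/= mulr_suml.
apply: eq_bigr => i _; rewrite -big_split/= mulr_suml.
by apply: eq_bigr => j _; rewrite partial2_frozen// -mulrDl subrKC mulrA.
Qed.

Let powR_le (x : R) : 0 <= x -> x `^ beta <= 1 + x.
Proof.
move=> x0; have x1 : 1 <= 1 + x by rewrite lerDl.
apply: (@le_trans _ _ ((1 + x) `^ beta)).
  by apply: ge0_ler_powR; rewrite ?nnegrE ?addr_ge0 ?lerDr// ltW.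
by rewrite -[leRHS]powRr1 ?addr_ge0// ler_powR.
Qed.

Let Ck : R := d%:R ^+ 2 * K * Ch + 1.

(** Hoelder continuity gains [n^beta] against the factor [1 / T] of the second derivatives. With
    [w = n / T], [n^beta / T = T^(beta - 1) w^beta <= T^(beta - 1) (1 + w)]: the singularity in [T]
    becomes integrable, and powers of [w] are left to the exponential. *)
Lemma kern_le y T x : 0 < T ->
  `|kern y T x| <= Ck * T `^ (beta - 1) * ((Num.sqrt T ^+ d)^-1 *
     ((1 + normsq (x - y) / T) ^+ 2 * expR (- (c * (normsq (x - y) / T))))).
Proof.
move=> T0; rewrite /kern normrM (ger0_norm (frozen_ge0 _ _ _)).
set n := normsq (x - y); have n0 : 0 <= n by exact: normsq_ge0.
set w := n / T; have w0 : 0 <= w by rewrite divr_ge0// ltW.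
have w1 : 0 <= 1 + w by rewrite addr_ge0.
have Tb : 0 <= T `^ (beta - 1) by exact: powR_ge0.
have nb : n `^ beta / T <= T `^ (beta - 1) * (1 + w).
  rewrite -[n](divfK (lt0r_neq0 T0)) powRM// ?(ltW T0)// -/w.
  have -> : T `^ beta = T `^ (beta - 1) * T.
    by rewrite -[X in _ * X]powRr1 ?(ltW T0)// -powRD ?subrK// (gt_eqF T0) implybT.
  by rewrite mulrA mulfK ?gt_eqF// mulrC ler_wpM2l// powR_le.
have h : `|\sum_(i < d) \sum_(j < d) (a x i j - a y i j) * hess y T x i j| <=
    Ck * T `^ (beta - 1) * (1 + w) ^+ 2.
  apply: (@le_trans _ _ (\sum_(i < d) \sum_(j < d) K * Ch * T `^ (beta - 1) * (1 + w) ^+ 2)).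
    apply: (le_trans (ler_norm_sum _ _ _)); apply: ler_sum => i _.
    apply: (le_trans (ler_norm_sum _ _ _)); apply: ler_sum => j _.
    rewrite normrM; apply: le_trans (ler_pM _ _ (a_holder i j x y) (hess_le y x i j T0)) _ => //.
    rewrite -/n -/w.
    have -> : K * n `^ beta * (Ch / T * (1 + w)) = K * Ch * ((n `^ beta / T) * (1 + w)) by ring.
    have -> : K * Ch * T `^ (beta - 1) * (1 + w) ^+ 2 = K * Ch * ((T `^ (beta - 1) * (1 + w)) * (1 + w)) by ring.
    by rewrite ler_pM2l ?mulr_gt0// ler_wpM2r.
  rewrite !sumr_const card_ord -!mulrnA -mulr_natl natrM.
  have -> : Ck * T `^ (beta - 1) * (1 + w) ^+ 2 =
      d%:R * d%:R * (K * Ch * T `^ (beta - 1) * (1 + w) ^+ 2) + T `^ (beta - 1) * (1 + w) ^+ 2.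
    by rewrite /Ck; ring.
  by rewrite lerDl mulr_ge0// sqr_ge0.
apply: (le_trans (ler_pM _ _ h (frozen_le y x T0))) => //; first exact: frozen_ge0.
by rewrite le_eqVlt; apply/orP; left; apply/eqP; rewrite -/n -/w; ring.
Qed.

Let C1ex := expR_absorb (divr_gt0 ltr01 (mulr_gt0 (ltr0n R 4) LM0)).

Lemma frozen_decay : exists2 C1 : R, 0 < C1 &
  forall (y : 'rV[R]_d) T x, 0 < T -> (1 + normsq (x - y) / T) ^+ 2 *
     expR (- (c * (normsq (x - y) / T))) <= C1.
Proof.
have [C1 C10 h] := C1ex; exists C1 => // y T x T0.
have w0 : 0 <= normsq (x - y) / T by rewrite divr_ge0 ?normsq_ge0// ltW.
apply: le_trans (h _ w0) _; rewrite ger_pMr// -expR0 ler_expR oppr_le0 mulr_ge0//.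
by rewrite divr_ge0// divr_ge0// mulr_ge0// ltW.
Qed.

(** The rate [1 / T] is not integrable at 0; the bound serves as a dominating constant at times
    bounded away from 0. *)
Lemma frozen_dt_le : exists2 C : R, 0 < C & forall (y : 'rV[R]_d) T x, 0 < T ->
  `|frozen_dt y T x| <= C * (T^-1 * (Num.sqrt T ^+ d)^-1).
Proof.
have [C1 C10 dec] := frozen_decay.
exists ((1 / (4 * Lm) + d%:R / 2) * C1) => [|y T x T0].
  by rewrite mulr_gt0// ltr_pwDl ?divr_ge0// divr_gt0// mulr_gt0.
rewrite /frozen_dt normrM (ger0_norm (frozen_ge0 _ _ _)).
have D0 : 0 < 1 / (4 * Lm) by rewrite divr_gt0// mulr_gt0.
set n := normsq (x - y); have n0 : 0 <= n by exact: normsq_ge0.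
have w0 : 0 <= n / T by rewrite divr_ge0// ltW.
have d0 : 0 <= d%:R / 2 :> R by rewrite divr_ge0.
have q0 : 0 <= quad (invmx (a y)) (x - y).
  by apply: le_trans (quad_inv_ge (a_sym y) Lm0 LmM (a_ell y) (x - y)); rewrite divr_ge0// ltW.
have q1 := quad_inv_le Lm0 (a_ell y) (x - y).
have h : `|quad (invmx (a y)) (x - y) / (4 * T ^+ 2) - d%:R / (2 * T)| <=
    (1 / (4 * Lm) + d%:R / 2) * T^-1 * (1 + n / T) ^+ 2.
  apply: le_trans (ler_normB _ _) _.
  rewrite !ger0_norm ?divr_ge0 ?mulr_ge0 ?exprn_ge0 ?(ltW T0)//.
  apply: (@le_trans _ _ (n / Lm / (4 * T ^+ 2) + d%:R / (2 * T))).
    by rewrite lerD2r ler_pM2r// invr_gt0 mulr_gt0// exprn_gt0.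
  have -> : n / Lm / (4 * T ^+ 2) + d%:R / (2 * T) = T^-1 * (1 / (4 * Lm) * (n / T) + d%:R / 2).
    by field; rewrite !gt_eqF.
  rewrite [leRHS]mulrAC [leRHS]mulrC ler_pM2l ?invr_gt0//.
  move: (n / T) (1 / (4 * Lm)) (d%:R / 2) w0 D0 d0 => w D e w0 /ltW D0 e0.
  have Dw := mulr_ge0 D0 w0; have ew := mulr_ge0 e0 w0.
  have := mulr_ge0 Dw w0; have := mulr_ge0 ew w0; nra.
apply: (le_trans (ler_pM _ _ h (frozen_le y x T0))) => //; first exact: frozen_ge0.
have := dec y T x T0; rewrite -/n; set e := (_ ^+ 2 * expR _) => eC.
apply: (@le_trans _ _ ((1 / (4 * Lm) + d%:R / 2) * (T^-1 * (Num.sqrt T ^+ d)^-1) * e)).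
  by rewrite le_eqVlt; apply/orP; left; apply/eqP; rewrite /e; ring.
apply: (@le_trans _ _ ((1 / (4 * Lm) + d%:R / 2) * (T^-1 * (Num.sqrt T ^+ d)^-1) * C1)).
  have D1 := addr_ge0 (ltW D0) d0.
  have T1 : 0 <= T^-1 by rewrite invr_ge0 ltW.
  have S0 : 0 <= (Num.sqrt T ^+ d)^-1 by rewrite invr_ge0 exprn_ge0// sqrtr_ge0.
  by apply: ler_wpM2l => //; exact: mulr_ge0 D1 (mulr_ge0 T1 S0).
by rewrite le_eqVlt; apply/orP; left; apply/eqP; ring.
Qed.

Lemma normsq_continuous (y : 'rV[R]_d) : continuous (fun x : 'rV[R]_d => normsq (x - y)).
Proof.
have -> : (fun x : 'rV[R]_d => normsq (x - y)) = (fun x => quad 1%:M (x - y)).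
  by apply/funext => x; rewrite quadE normsqE mulmx1.
exact: quad_continuous.
Qed.

Lemma holder_continuous i j : continuous (fun x => a x i j).
Proof.
move=> y; apply: (holder_continuous_at K0 beta0 (@normsq_continuous y)) => [|x|x].
- by rewrite subrr /normsq big1// => k _; rewrite mxE expr0n.
- exact: normsq_ge0.
- exact: a_holder.
Qed.

(** A weight of degree at most two in [normsq (x - y) / T] is absorbed by the Gaussian; this gives
    all the bounds required by [Cb2]. *)
Let weight_frozen_le : exists2 C : R, 0 < C & forall (y : 'rV[R]_d) T x h B, 0 < T ->
  `|h| <= B * (1 + normsq (x - y) / T) ^+ 2 ->
  `|h * frozen y T x| <= B * ((Num.sqrt T ^+ d)^-1 * C).
Proof.
have [C1 C10 dec] := frozen_decay; exists C1 => // y T x h B T0 hB.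
rewrite normrM (ger0_norm (frozen_ge0 _ _ _)).
apply: (le_trans (ler_pM _ _ hB (frozen_le y x T0))) => //; first exact: frozen_ge0.
have S0 : 0 <= (Num.sqrt T ^+ d)^-1 by rewrite invr_ge0 exprn_ge0// sqrtr_ge0.
have B0 : 0 <= B.
  rewrite -(pmulr_lge0 _ (_ : 0 < (1 + normsq (x - y) / T) ^+ 2)); first exact: le_trans hB.
  by rewrite exprn_gt0// ltr_pwDl// divr_ge0 ?normsq_ge0// ltW.
rewrite -mulrA; apply: ler_wpM2l => //; rewrite mulrCA; apply: ler_wpM2l => //.
exact: dec.
Qed.

Lemma frozen_Cb2 y T : 0 < T -> Cb2 (frozen y T).
Proof.
move=> T0; have [C C0 bnd] := weight_frozen_le.
have w0 x : 0 <= normsq (x - y) / T by rewrite divr_ge0 ?normsq_ge0// ltW.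
have w1 x : 1 <= 1 + normsq (x - y) / T by rewrite lerDl.
have w2 x : 1 + normsq (x - y) / T <= (1 + normsq (x - y) / T) ^+ 2.
  by rewrite expr2 ler_peMl ?w1// (le_trans _ (w1 x)).
split; first exact: gauss_C2.
- apply: (@bounded_fun_le _ _ _ (1 * ((Num.sqrt T ^+ d)^-1 * C))) => x.
  by rewrite -[frozen y T x]mul1r; apply: bnd => //; rewrite normr1 mul1r (le_trans (w1 x)).
- move=> i; rewrite /frozen partial_gauss//.
  (* Chosen from [|u| <= 1 + u^2 <= 1 + normsq (x - y) / Lm^2 <= (1 + T / Lm^2) (1 + normsq (x - y)
     / T)]. *)
  pose B := (1 + T / Lm ^+ 2) / (2 * T).
  apply: (@bounded_fun_le _ _ _ (B * ((Num.sqrt T ^+ d)^-1 * C))) => x.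
  apply: bnd => //; have := coord2 y x i; set u := _ 0 i => u2.
  apply: (@le_trans _ _ (B * (1 + normsq (x - y) / T))); last first.
    by rewrite ler_wpM2l// divr_ge0 ?addr_ge0 ?divr_ge0 ?mulr_ge0 ?exprn_ge0 ?ltW.
  have T2 : 0 < 2 * T by rewrite mulr_gt0.
  rewrite normrM normrN normfV (gtr0_norm T2) /B mulrAC ler_pM2r ?invr_gt0//.
  apply: (@le_trans _ _ (1 + u ^+ 2)).
    by rewrite -[u ^+ 2]real_normK ?num_real//; have := sqr_ge0 (`|u| - 1); nra.
  apply: (@le_trans _ _ (1 + normsq (x - y) / Lm ^+ 2)); first by rewrite lerD2l.
  have -> : (1 + T / Lm ^+ 2) * (1 + normsq (x - y) / T) =
    1 + normsq (x - y) / Lm ^+ 2 + (T / Lm ^+ 2 + normsq (x - y) / T).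
    by field; rewrite !gt_eqF.
  by rewrite lerDl addr_ge0// divr_ge0 ?exprn_ge0 ?ltW.
- move=> i j; rewrite partial2_frozen//.
  apply: (@bounded_fun_le _ _ _ (Ch / T * ((Num.sqrt T ^+ d)^-1 * C))) => x.
  apply: bnd => //; apply: (le_trans (hess_le y x i j T0)).
  by rewrite ler_wpM2l ?divr_ge0 ?(ltW Ch_gt0) ?(ltW T0).
Qed.

Lemma kern_bounded y T : 0 < T -> exists C, forall x, `|kern y T x| <= C.
Proof.
move=> T0; have [C1 C10 dec] := frozen_decay.
exists (Ck * T `^ (beta - 1) * ((Num.sqrt T ^+ d)^-1 * C1)) => x.
apply: le_trans (kern_le y x T0) _.
have S0 : 0 <= (Num.sqrt T ^+ d)^-1 by rewrite invr_ge0 exprn_ge0// sqrtr_ge0.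
have Ck0 : 0 <= Ck by rewrite addr_ge0// !mulr_ge0 ?sqr_ge0// ltW.
apply: ler_wpM2l; first exact: mulr_ge0 Ck0 (powR_ge0 _ _).
by apply: ler_wpM2l => //; exact: dec.
Qed.

Lemma kern_continuous y T : 0 < T -> continuous (kern y T).
Proof.
move=> T0; apply: continuous_mulf; last exact: gauss_continuous.
apply: continuous_sum => i; apply: continuous_sum => j.
apply: continuous_mulf.
  by apply: continuous_subf; [exact: holder_continuous|exact: continuous_cstf].
apply: continuous_subf; last exact: continuous_cstf.
by apply: continuous_mulf; [apply: continuous_mulf; exact: slope_continuous|exact: continuous_cstf].
Qed.

Lemma frozen_cvg (y : 'rV[R]_d) (T : nat -> R) (x : nat -> 'rV[R]_d) (T0 : R) (x0 : 'rV[R]_d) : 0 < T0 ->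
  T n @[n --> \oo] --> T0 -> x n @[n --> \oo] --> x0 ->
  frozen y (T n) (x n) @[n --> \oo] --> frozen y T0 x0.
Proof.
move=> T0_gt0 TT xx.
have q : quad (invmx (a y)) (x n - y) @[n --> \oo] --> quad (invmx (a y)) (x0 - y).
  have qc : continuous (fun z : 'rV[R]_d => quad (invmx (a y)) (z - y)) by exact: quad_continuous.
  exact: (@cvg_comp _ _ _ x (fun z => quad (invmx (a y)) (z - y)) _ _ _ xx (qc x0)).
apply: (@cvg_comp _ _ _ (fun n => - (d%:R / 2 * ln (T n)) - quad (invmx (a y)) (x n - y) / (4 * T n)) (@expR R) _ _ _ _ (@continuous_expR R _)).
apply: cvgB.
  apply: cvgN; apply: cvgMl_tmp.
  exact: (@cvg_comp _ _ _ T (@ln R) _ _ _ TT (continuous_ln T0_gt0)).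
by apply: cvgM => //; apply: cvgV; [rewrite mulf_neq0// gt_eqF|exact: cvgMl_tmp].
Qed.

Lemma frozen_dt_cvg (y : 'rV[R]_d) (T : nat -> R) (x : nat -> 'rV[R]_d) (T0 : R) (x0 : 'rV[R]_d) : 0 < T0 ->
  T n @[n --> \oo] --> T0 -> x n @[n --> \oo] --> x0 ->
  frozen_dt y (T n) (x n) @[n --> \oo] --> frozen_dt y T0 x0.
Proof.
move=> T0_gt0 TT xx.
have q : quad (invmx (a y)) (x n - y) @[n --> \oo] --> quad (invmx (a y)) (x0 - y).
  have qc : continuous (fun z : 'rV[R]_d => quad (invmx (a y)) (z - y)) by exact: quad_continuous.
  exact: (@cvg_comp _ _ _ x (fun z => quad (invmx (a y)) (z - y)) _ _ _ xx (qc x0)).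
apply: cvgM; last exact: frozen_cvg.
apply: cvgB.
  apply: cvgM => //; apply: cvgV; first by rewrite mulf_neq0// gt_eqF// exprn_gt0.
  by apply: cvgMl_tmp; apply: cvgM.
by apply: cvgMl_tmp; apply: cvgV; [rewrite mulf_neq0// gt_eqF|exact: cvgMl_tmp].
Qed.

End frozen_gaussian.

(** * Approximation of the identity on a grid *)

(** The topology comes from the sup norm, and every coordinate is dominated by the Euclidean norm;
    the radius is squared because [normsq] is. *)
Lemma ball_normsq (R : realType) (d : nat) (x : 'rV[R]_d) (U : set 'rV[R]_d) :
  nbhs x U -> exists2 rho : R, 0 < rho & forall y, normsq (x - y) < rho -> U y.
Proof.
move=> /nbhs_ballP[e /= e0 eU]; exists (e ^+ 2); first by rewrite exprn_gt0.
move=> y xy; apply: eU; split => // i j; rewrite ord1 /ball/=.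
rewrite -(ltr_pXn2r (ltn0Sn 1)) ?nnegrE ?(ltW e0)// real_normK ?num_real//.
by apply: le_lt_trans xy; have := coord_le_normsq (x - y) j; rewrite !mxE.
Qed.

Section grid_approximation.
Context (R : realType) (d : nat) (a : 'rV[R]_d -> 'M[R]_d) (Lm LM K beta : R).
Hypothesis a_sym : forall x, (a x)^T = a x.
Hypotheses (Lm0 : 0 < Lm) (LmM : Lm <= LM).
Hypothesis a_ell : forall x z, Lm * normsq z <= quad (a x) z /\ quad (a x) z <= LM * normsq z.
Hypotheses (K0 : 0 < K) (beta0 : 0 < beta) (beta1 : beta <= 1).
Hypothesis a_holder : forall i j x y, `|a x i j - a y i j| <= K * normsq (x - y) `^ beta.

Let c := 1 / (4 * LM).
Let c_gt0 : 0 < c.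
Proof. by rewrite divr_gt0// mulr_gt0// (lt_le_trans Lm0). Qed.

(** The factor [delta^d] joins the [T^(-d/2)] of [kern_le] to form the weight of [lattice_sum], so
    only the singularity [T^(beta - 1)] depends on [T]. *)
Lemma kern_sum_le : exists2 C : R, 0 < C &
  forall N L delta T x (f : 'rV[R]_d -> R), 0 < delta -> delta ^+ 2 <= T -> (forall y, `|f y| <= 1) ->
  `|\sum_(k : {ffun 'I_d -> 'I_N}) f (grid_point delta L k) *
      (delta ^+ d * kern a (grid_point delta L k) T x)| <= C * T `^ (beta - 1).
Proof.
have [C C0 lat] := lattice_sum d c_gt0.
pose Ck := d%:R ^+ 2 * K * (1 / (4 * Lm ^+ 2) + 1 / (2 * Lm)) + 1.
have Ck0 : 0 < Ck.
  rewrite ltr_wpDl// !mulr_ge0 ?sqr_ge0 ?(ltW K0)// addr_ge0// divr_ge0// mulr_ge0//.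
    by rewrite sqr_ge0.
  exact: ltW.
exists (Ck * C) => [|N L delta T x f delta0 dT f1]; first exact: mulr_gt0.
have T0 : 0 < T by apply: lt_le_trans dT; rewrite exprn_gt0.
apply: (le_trans (ler_norm_sum _ _ _)).
have -> : Ck * C * T `^ (beta - 1) = Ck * T `^ (beta - 1) * C by ring.
have CT0 : 0 <= Ck * T `^ (beta - 1) by rewrite mulr_ge0 ?powR_ge0// ltW.
apply: le_trans (ler_wpM2l CT0 (lat N L delta T x delta0 T0 dT)).
rewrite mulr_sumr; apply: ler_sum => k _.
rewrite normrM; apply: le_trans (ler_wpM2r (normr_ge0 _) (f1 _)) _.
rewrite mul1r normrM (ger0_norm (exprn_ge0 _ (ltW delta0))).
have h := kern_le a_sym Lm0 LmM a_ell K0 beta0 beta1 a_holder (grid_point delta L k) x T0.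
apply: le_trans (ler_wpM2l (exprn_ge0 _ (ltW delta0)) h) _.
rewrite le_eqVlt; apply/orP; left; apply/eqP.
by rewrite -/Ck -/c expr_div_n; ring.
Qed.

Definition mesh (n : nat) : R := n.+1%:R^-1.

(** The grid of step [1 / (n + 1)] fills the cube [[-(n + 1), n + 1]^d]. The kernel time
    [mesh n ^ 2] makes the Gaussian width comparable to the step, so the total weight stays between
    positive constants without being 1. *)
Definition approx (n : nat) (f : 'rV[R]_d -> R) (x : 'rV[R]_d) : R :=
  \sum_(k : {ffun 'I_d -> 'I_(2 * n.+1 ^ 2).+1}) f (grid_point (mesh n) (n.+1 ^ 2) k) *
     (mesh n ^+ d * frozen a (grid_point (mesh n) (n.+1 ^ 2) k) (mesh n ^+ 2) x).

Let mesh_gt0 n : 0 < mesh n. Proof. by rewrite invr_gt0. Qed.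
Let mesh2_gt0 n : 0 < mesh n ^+ 2. Proof. by rewrite exprn_gt0. Qed.
Let sqrt_mesh2 n : Num.sqrt (mesh n ^+ 2) = mesh n.
Proof. by rewrite sqrtr_sqr ger0_norm// ltW. Qed.

Let frozen_weight_le n y x :
  mesh n ^+ d * frozen a y (mesh n ^+ 2) x <= expR (- (c * (normsq (x - y) / mesh n ^+ 2))).
Proof.
have := frozen_le a_sym Lm0 LmM a_ell y x (mesh2_gt0 n); rewrite sqrt_mesh2.
by move=> h; rewrite -ler_pdivlMl ?exprn_gt0.
Qed.

(** One factor [1 + w] of growth, [w] the scaled squared distance, is within the squared weight of
    [lattice_sum]. Constant [h] gives a uniform bound on [approx]; the growth handles distant grid
    points. *)
Lemma weighted_approx_le : exists2 C : R, 0 < C &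
  forall n (h : 'rV[R]_d -> R) x B, 0 <= B ->
    (forall y, `|h y| <= B * (1 + normsq (x - y) / mesh n ^+ 2)) ->
    `|approx n h x| <= B * C.
Proof.
have [C C0 lat] := lattice_sum d c_gt0; exists C => // n h x B B0 hB.
have := lat (2 * n.+1 ^ 2).+1 (n.+1 ^ 2)%N (mesh n) (mesh n ^+ 2) x (mesh_gt0 n) (mesh2_gt0 n) (lexx _).
rewrite sqrt_mesh2 divff ?gt_eqF// expr1n => {}lat.
apply: le_trans (ler_wpM2l B0 lat); rewrite mulr_sumr.
apply: (le_trans (ler_norm_sum _ _ _)); apply: ler_sum => k _.
set y := grid_point _ _ k; set w := normsq (x - y) / _; rewrite mul1r.
have w0 : 0 <= w by rewrite divr_ge0 ?normsq_ge0// ltW.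
have w1 : 0 <= 1 + w by rewrite addr_ge0.
have f0 : 0 <= mesh n ^+ d * frozen a y (mesh n ^+ 2) x.
  by rewrite mulr_ge0 ?frozen_ge0// exprn_ge0// ltW.
rewrite normrM (ger0_norm f0).
apply: le_trans (ler_pM (normr_ge0 _) f0 (hB y) (frozen_weight_le n y x)) _.
rewrite -/w -mulrA; apply: ler_wpM2l => //; rewrite expr2 ler_wpM2r ?expR_ge0//.
by rewrite ler_peMl// lerDl.
Qed.

(** The kernel is not normalized, so [f x] is compared after multiplication by the total weight. The
    difference is [approx] of [f - f x], small near [x] by continuity and damped by the Gaussian far
    away. *)
Lemma approx_error (f : 'rV[R]_d -> R) x : continuous f -> (forall y, `|f y| <= 1) ->
  approx n f x - approx n (fun=> 1) x * f x @[n --> \oo] --> (0 : R).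
Proof.
move=> cf f1; have [C C0 app] := weighted_approx_le.
have E n : approx n f x - approx n (fun=> 1) x * f x = approx n (fun y => f y - f x) x.
  rewrite /approx mulr_suml -sumrB; apply: eq_bigr => k _.
  by rewrite mul1r mulrBl [X in _ - X]mulrC.
apply/cvgrPdist_le => e e0; pose eta := e / (2 * C).
have eta0 : 0 < eta by rewrite divr_gt0// mulr_gt0.
have [rho rho0 rhoP] : exists2 rho : R, 0 < rho & forall y, normsq (x - y) < rho -> `|f x - f y| <= eta.
  by apply: (@ball_normsq R d x [set y | `|f x - f y| <= eta]); move/cvgrPdist_le : (cf x) => /(_ _ eta0).
have mesh_cvg : (2 / rho) * mesh n @[n --> \oo] --> (0 : R).
  rewrite -[X in _ --> X](mulr0 (2 / rho)); apply: cvgMl_tmp; exact: cvg_harmonic.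
near=> n; rewrite sub0r normrN E.
have small : 2 / rho * mesh n <= eta by near: n; apply: (cvgr_le 0 mesh_cvg).
have m1 : mesh n <= 1 by rewrite invf_le1// ler1n.
apply: (@le_trans _ _ (2 * eta * C)); last first.
  by rewrite le_eqVlt; apply/orP; left; apply/eqP; rewrite /eta; field; rewrite gt_eqF.
apply: app; first by rewrite mulr_ge0// ltW.
move=> y; set w := normsq (x - y) / mesh n ^+ 2.
have w0 : 0 <= w by rewrite divr_ge0 ?normsq_ge0// ltW.
have [near_x|far] := ltP (normsq (x - y)) rho.
  rewrite distrC (le_trans (rhoP y near_x))//.
  have := mulr_ge0 (ltW eta0) w0; lra.
(* Far from [x], [normsq (x - y) >= rho] gives [2 <= 2 w mesh^2 / rho], and a fine mesh turns this
   into at most [eta * w]. *)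
apply: (@le_trans _ _ 2).
  by rewrite (le_trans (ler_normB _ _))//; have := f1 y; have := f1 x; lra.
have : 2 <= 2 * (w * mesh n ^+ 2 / rho).
  by rewrite /w divfK ?gt_eqF// ler_peMr// ler_pdivlMr// mul1r.
have : 2 * (w * mesh n ^+ 2 / rho) <= eta * w.
  have -> : 2 * (w * mesh n ^+ 2 / rho) = 2 / rho * mesh n * (w * mesh n) by rewrite expr2; ring.
  apply: ler_pM => //; last by rewrite ler_piMr.
    by rewrite mulr_ge0 ?divr_ge0// ltW.
  by rewrite mulr_ge0// ltW.
have := mulr_ge0 (ltW eta0) w0; lra.
Unshelve. all: by end_near. Qed.

(** A single term suffices: once the cube contains [x], some grid point lies within one step of [x]
    in each coordinate, and at squared distance at most [d mesh^2] the Gaussian of time [mesh^2] has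
    exponent at least [- d / (4 Lm)]. *)
Lemma approx_ge x : \forall n \near \oo, expR (- (d%:R / (4 * Lm))) <= approx n (fun=> 1) x.
Proof.
have [B xB] : exists B : nat, forall i, `|x 0 i| <= B%:R.
  pose b (i : 'I_d) := (Num.truncn `|x 0 i|).+1.
  exists (\max_i b i)%N => i.
  apply: (@le_trans _ _ (b i)%:R); first by rewrite ltW// truncnS_gt.
  by rewrite ler_nat; exact: (@leq_bigmax _ b i).
near=> n.
have nB : (B <= n.+1)%N by near: n; exists B => // m /= /leqW.
have mL : mesh n * (n.+1 ^ 2)%:R = n.+1%:R by rewrite /mesh natrX expr2 mulrA mulVf ?mul1r.
have xn i : `|x 0 i| <= n.+1%:R by rewrite (le_trans (xB i))// ler_nat.
(* The position of [x] above the lower face of the cube, in steps; its integer part is the index of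
   the grid coordinate just below. *)
pose q i : R := (x 0 i + n.+1%:R) / mesh n.
have q0 i : 0 <= q i by rewrite divr_ge0 ?(ltW (mesh_gt0 n))//; have := xn i; rewrite ler_norml; lra.
have kP i : (Num.truncn (q i) < (2 * n.+1 ^ 2).+1)%N.
  rewrite ltnS -(ler_nat R); apply: (@le_trans _ _ (q i)); first by rewrite truncn_le.
  rewrite /q ler_pdivrMr// natrM mulrAC -mulrA mL mulr_natl mulr2n.
  by rewrite lerD2r; have := xn i; rewrite ler_norml => /andP[].
pose k : {ffun 'I_d -> 'I_(2 * n.+1 ^ 2).+1} := [ffun i => Ordinal (kP i)].
set y := grid_point (mesh n) (n.+1 ^ 2) k.
have xy : normsq (x - y) <= d%:R * mesh n ^+ 2.
  rewrite /normsq -[in leRHS](card_ord d) mulr_natl -sumr_const; apply: ler_sum => i _.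
  have -> : (x - y) 0 i = mesh n * (q i - (Num.truncn (q i))%:R).
    have mq : mesh n * q i = x 0 i + n.+1%:R by rewrite /q mulrC divfK ?gt_eqF.
    by rewrite /y !mxE ffunE /= !mulrBr mL mq; ring.
  rewrite exprMn ler_piMr ?(ltW (mesh2_gt0 n))//.
  have /andP[] := truncn_itv (q0 i); rewrite -natr1 => h1 h2.
  by rewrite exprn_ile1//; lra.
rewrite /approx (bigD1 k)//= -/y mul1r.
apply: (@le_trans _ _ (mesh n ^+ d * frozen a y (mesh n ^+ 2) x)); last first.
  rewrite lerDl; apply: sumr_ge0 => k' _.
  by rewrite mul1r mulr_ge0 ?frozen_ge0// exprn_ge0// ltW.
rewrite -ler_pdivrMl ?exprn_gt0//.
have := frozen_ge Lm0 a_ell y x (mesh2_gt0 n); rewrite sqrt_mesh2; apply: le_trans.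
rewrite ler_wpM2l ?invr_ge0 ?exprn_ge0 ?(ltW (mesh_gt0 n))// ler_expR lerN2.
rewrite ler_pdivrMr ?mulr_gt0// (le_trans xy)//.
by rewrite le_eqVlt; apply/orP; left; apply/eqP; field; rewrite gt_eqF.
Unshelve. all: by end_near. Qed.


End grid_approximation.

(** * The short-time comparison of two solutions *)

Section ev_theory.
Context (R : realType) (d : nat) (P : probability (Omega R d) R) (A : set (Omega R d)).
Hypothesis mA : measurable A.

Definition bounded_continuous (h : 'rV[R]_d -> R) : Prop :=
  continuous h /\ exists C, forall x, `|h x| <= C.

Lemma evZ t c h : bounded_continuous h -> ev P A t (fun x => c * h x) = c * ev P A t h.
Proof. by move=> [ch [C hC]]; rewrite /ev (RintegralZl c mA (ev_integrable P t mA ch hC)). Qed.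

Lemma evD t g h : bounded_continuous g -> bounded_continuous h ->
  ev P A t (fun x => g x + h x) = ev P A t g + ev P A t h.
Proof.
move=> [cg [C gC]] [ch [D hD]].
by rewrite /ev (RintegralD mA (ev_integrable P t mA cg gC) (ev_integrable P t mA ch hD)).
Qed.

Lemma bounded_continuousZ c h : bounded_continuous h -> bounded_continuous (fun x => c * h x).
Proof.
move=> [ch [C hC]]; split; first by apply: continuous_mulf => //; exact: continuous_cstf.
by exists (`|c| * C) => x; rewrite normrM ler_wpM2l.
Qed.

Lemma bounded_continuousD g h : bounded_continuous g -> bounded_continuous h ->
  bounded_continuous (fun x => g x + h x).
Proof.
move=> [cg [C gC]] [ch [D hD]]; split; first exact: continuous_addf.
by exists (C + D) => x; rewrite (le_trans (ler_normD _ _))// lerD.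
Qed.

Lemma bounded_continuous_sum (I : Type) (r : seq I) (c : I -> R) (h : I -> 'rV[R]_d -> R) :
  (forall i, bounded_continuous (h i)) -> bounded_continuous (fun x => \sum_(i <- r) c i * h i x).
Proof.
move=> bh; elim: r => [|i r IH].
  under eq_fun do rewrite big_nil; split; first exact: continuous_cstf.
  by exists 0 => x; rewrite normr0.
under eq_fun do rewrite big_cons.
by apply: bounded_continuousD => //; exact: bounded_continuousZ.
Qed.

Lemma ev_sum t (I : Type) (r : seq I) (c : I -> R) (h : I -> 'rV[R]_d -> R) :
  (forall i, bounded_continuous (h i)) ->
  ev P A t (fun x => \sum_(i <- r) c i * h i x) = \sum_(i <- r) c i * ev P A t (h i).
Proof.
move=> bh; elim: r => [|i r IH].
  rewrite big_nil; under eq_fun do rewrite big_nil.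
  by rewrite /ev (Rintegral_cst _ mA) mul0r.
rewrite big_cons -IH -evZ// -evD; last 2 first.
- exact: bounded_continuousZ.
- exact: bounded_continuous_sum.
by congr (ev P A t _); apply/funext => x; rewrite big_cons.
Qed.

Lemma ev_le t C h : continuous h -> (forall x, `|h x| <= C) -> `|ev P A t h| <= C.
Proof.
move=> ch hC.
exact: (bounded_Rintegral_le P mA (measurable_clipped_path t ch) (fun omega => hC (clipped_path t omega))).
Qed.

Lemma ev_cvg (u : nat -> R) s C (h_ : nat -> 'rV[R]_d -> R) h :
  (forall n, continuous (h_ n)) -> (forall n x, `|h_ n x| <= C) ->
  (forall omega : Omega R d, h_ n (clipped_path (u n) omega) @[n --> \oo] --> h (clipped_path s omega)) ->
  ev P A (u n) (h_ n) @[n --> \oo] --> ev P A s h.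
Proof.
move=> ch hC h_cvg.
exact: (bounded_Rintegral_cvg mA (fun n => measurable_clipped_path (u n) (ch n))
  (fun n omega => hC n (clipped_path (u n) omega)) h_cvg).
Qed.

End ev_theory.

(** * Frozen Gaussians along one solution *)

Section frozen_evolution.
Context (R : realType) (d : nat) (a : 'rV[R]_d -> 'M[R]_d) (Lm LM K beta : R).
Hypothesis a_sym : forall x, (a x)^T = a x.
Hypotheses (Lm0 : 0 < Lm) (LmM : Lm <= LM).
Hypothesis a_ell : forall x z, Lm * normsq z <= quad (a x) z /\ quad (a x) z <= LM * normsq z.
Hypotheses (K0 : 0 < K) (beta0 : 0 < beta) (beta1 : beta <= 1).
Hypothesis a_holder : forall i j x y, `|a x i j - a y i j| <= K * normsq (x - y) `^ beta.

Lemma kern_bounded_continuous y T : 0 < T -> bounded_continuous (kern a y T).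
Proof.
move=> T0; split; first exact: (kern_continuous K0 beta0 a_holder T0).
exact: (kern_bounded a_sym Lm0 LmM a_ell K0 beta0 beta1 a_holder y T0).
Qed.

Lemma frozen_bound y T x : 0 < T -> `|frozen a y T x| <= (Num.sqrt T ^+ d)^-1.
Proof.
move=> T0; rewrite ger0_norm ?frozen_ge0//.
apply: (le_trans (frozen_le a_sym Lm0 LmM a_ell y x T0)).
rewrite ger_pMr ?invr_gt0 ?exprn_gt0 ?sqrtr_gt0// -expR0 ler_expR oppr_le0.
have LM0 : 0 < LM by exact: lt_le_trans LmM.
by rewrite mulr_ge0// divr_ge0 ?normsq_ge0 ?(ltW T0)// mulr_ge0// ltW.
Qed.

Lemma frozen_bounded_continuous y T : 0 < T -> bounded_continuous (frozen a y T).
Proof.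
move=> T0; split; first exact: gauss_continuous.
by exists ((Num.sqrt T ^+ d)^-1) => x; exact: frozen_bound.
Qed.

Context (P : probability (Omega R d) R).
Hypothesis P_martingale : forall f : 'rV[R]_d -> R, Cb2 f ->
  martingale P (@coord_filtration R d)
    (fun t omega =>
       f (coord_process t omega) - f (coord_process 0 omega) -
       (\int[@lebesgue_measure R]_(s in `[0, t]) generator a f (coord_process s omega))%R).
Context (s0 t eps : R) (A : set (Omega R d)) (y : 'rV[R]_d).
Hypotheses (s0_ge0 : 0 <= s0) (FA : coord_filtration s0 A) (eps0 : 0 < eps).

(** The Gaussian time [eps + (t - s)] decreases in [s], so the explicit time dependence contributes
    minus [frozen_dt]. This cancels the [L^y] part of the generator and leaves [kern]; [eps] keeps
    the Gaussian time away from the singularity. *)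
Lemma is_derive_ev_frozen s : s0 < s < t ->
  is_derive s 1 (fun s => ev P A s (frozen a y (eps + (t - s))))
    (ev P A s (kern a y (eps + (t - s)))).
Proof.
move=> sI; pose T r := eps + (t - r).
have Tge r : s0 < r < t -> eps <= T r by case/andP => _ /ltW rt; rewrite lerDl subr_ge0.
have T0 r (rI : s0 < r < t) : 0 < T r := lt_le_trans eps0 (Tge r rI).
have [C1 C10 dt1] := frozen_dt_le a_sym Lm0 LmM a_ell.
have [C2 k2] := kern_bounded a_sym Lm0 LmM a_ell K0 beta0 beta1 a_holder y (T0 s sI).
have C2_ge0 : 0 <= C2 by exact: le_trans (k2 0).
pose C := C1 * (eps^-1 * (Num.sqrt eps ^+ d)^-1).
have dtC r x : s0 < r < t -> `|frozen_dt a y (T r) x| <= C.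
  move=> rI; apply: (le_trans (dt1 y (T r) x (T0 r rI))).
  apply: ler_wpM2l; first exact: ltW.
  have TT := T0 r rI; have Te := Tge r rI.
  apply: ler_pM; rewrite ?invr_ge0 ?(ltW TT) ?exprn_ge0 ?sqrtr_ge0//.
    by rewrite lef_pV2.
  rewrite lef_pV2 ?posrE ?exprn_gt0 ?sqrtr_gt0//.
  by apply: lerXn2r; rewrite ?nnegrE ?sqrtr_ge0// ler_wsqrtr.
have := @is_derive_ev R d a (holder_continuous K0 beta0 a_holder) P P_martingale
  (fun r => frozen a y (T r)) (fun r x => - frozen_dt a y (T r) x) s0 t s (C + C2) A s0_ge0 FA sI.
have -> : (fun x => generator a (frozen a y (T s)) x + - frozen_dt a y (T s) x) = kern a y (T s).
  by apply/funext => x; rewrite (generator_frozen a_sym Lm0 a_ell y x (T0 s sI)) addrC addKr.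
apply.
- by move=> r rI; exact: (frozen_Cb2 a_sym Lm0 LmM a_ell y (T0 r rI)).
- move=> r x rI.
  have dT : is_derive r 1 T (-1).
    have h : is_derive r 1 (cst eps + (cst t - id) : R -> R) (-1).
      apply: (is_derive_eq (is_deriveD (is_derive_cst eps r 1)
        (is_deriveB (is_derive_cst t r 1) (is_derive_id r 1)))).
      by rewrite !add0r.
    exact: h.
  have := is_derive1_comp (is_derive_time_gauss (invmx (a y)) y x (T0 r rI)) dT.
  by move=> h; apply: is_derive_eq h _; rewrite mulrN1.
- by move=> r x rI; rewrite normrN (le_trans (dtC r x rI))// lerDl.
- move=> u x x0 uI us xx; apply: cvgN; apply: frozen_dt_cvg => //; first exact: T0.
  by apply: cvgD; [exact: cvg_cst|apply: cvgB => //; exact: cvg_cst].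
- move=> x; rewrite (generator_frozen a_sym Lm0 a_ell y x (T0 s sI)).
  by rewrite (le_trans (ler_normD _ _))// lerD// dtC.
Qed.

(** Supplies the end points of the time interval, which the derivative does not reach. For [s = t]
    the approximating times may exceed [t], but eventually the Gaussian time stays above [eps / 2],
    which bounds the Gaussians uniformly. *)
Lemma ev_frozen_continuous (s : R) : s <= t ->
  {for s, continuous (fun s => ev P A s (frozen a y (eps + (t - s))))}.
Proof.
move=> st; have mA := coord_filtration_measurable s0_ge0 FA.
apply/(@cvg_nbhsP R R^o) => u us.
have T_cvg : eps + (t - u n) @[n --> \oo] --> eps + (t - s).
  by apply: cvgD; [exact: cvg_cst|apply: cvgB => //; exact: cvg_cst].
have Ts : eps / 2 < eps + (t - s) by rewrite ltr_wpDr ?subr_ge0// ltr_pdivrMr// ltr_pMr// ltr1n.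
have e2 : 0 < eps / 2 by rewrite divr_gt0.
have [N _ HN] : \forall n \near \oo, eps / 2 < eps + (t - u n) by exact: (cvgr_gt _ T_cvg).
rewrite -(cvg_shiftn N) /=.
apply: (@ev_cvg R d P A mA (fun n => u (n + N)%N) s ((Num.sqrt (eps / 2) ^+ d)^-1)
  (fun n => frozen a y (eps + (t - u (n + N)%N)))).
- by move=> n; exact: gauss_continuous.
- move=> n x; have h : eps / 2 < eps + (t - u (n + N)%N) by apply: HN; exact: leq_addl.
  have h0 := lt_trans e2 h; apply: le_trans (frozen_bound y x h0) _.
  rewrite lef_pV2 ?posrE ?exprn_gt0 ?sqrtr_gt0//.
  by apply: lerXn2r; rewrite ?nnegrE ?sqrtr_ge0// ler_wsqrtr// ltW.
- move=> omega; apply: frozen_cvg; first exact: lt_trans Ts.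
    by rewrite (cvg_shiftn N (fun n => eps + (t - u n))).
  apply: clipped_path_cvg.
  by rewrite (cvg_shiftn N u).
Qed.

End frozen_evolution.

Lemma is_derive_bigsum (R : realType) (I : Type) (r : seq I) (F : I -> R -> R) (dF : I -> R) (s : R) :
  (forall i, is_derive s 1 (F i) (dF i)) ->
  is_derive s 1 (fun u => \sum_(i <- r) F i u) (\sum_(i <- r) dF i).
Proof.
move=> FdF; elim: r => [|i r IH].
  rewrite big_nil; under eq_fun do rewrite big_nil; exact: is_derive_cst.
rewrite big_cons; under eq_fun do rewrite big_cons.
exact: (is_deriveD (FdF i) IH).
Qed.

(** * The gap between two solutions *)

Section two_solutions.
Context (R : realType) (d : nat) (P1 P2 : probability (Omega R d) R) (A : set (Omega R d)).
Hypothesis mA : measurable A.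

Definition gap (t : R) (h : 'rV[R]_d -> R) : R := ev P1 A t h - ev P2 A t h.

Definition test_function (h : 'rV[R]_d -> R) : Prop :=
  continuous h /\ forall x, `|h x| <= 1.

Lemma test_bounded_continuous h : test_function h -> bounded_continuous h.
Proof. by move=> [ch h1]; split => //; exists 1. Qed.

Lemma gapZ t c h : bounded_continuous h -> gap t (fun x => c * h x) = c * gap t h.
Proof. by move=> bh; rewrite /gap !evZ// mulrBr. Qed.

Lemma gapD t g h : bounded_continuous g -> bounded_continuous h ->
  gap t (fun x => g x + h x) = gap t g + gap t h.
Proof. by move=> bg bh; rewrite /gap !evD// opprD addrACA. Qed.

Lemma gap_sum t (I : Type) (r : seq I) (c : I -> R) (h : I -> 'rV[R]_d -> R) :
  (forall i, bounded_continuous (h i)) ->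
  gap t (fun x => \sum_(i <- r) c i * h i x) = \sum_(i <- r) c i * gap t (h i).
Proof.
by move=> bh; rewrite /gap !ev_sum// -sumrB; apply: eq_bigr => i _; rewrite mulrBr.
Qed.

Lemma gap_scaled t h B M : continuous h -> 0 < B -> (forall x, `|h x| <= B) ->
  (forall g, test_function g -> gap t g <= M) -> gap t h <= B * M.
Proof.
move=> ch B0 hB gM.
have th : test_function (fun x => B^-1 * h x).
  split; first by apply: continuous_mulf => //; exact: continuous_cstf.
  move=> x; rewrite normrM gtr0_norm ?invr_gt0// mulrC ler_pdivrMr// mul1r.
  exact: hB.
have -> : gap t h = B * gap t (fun x => B^-1 * h x).
  rewrite gapZ; last by split => //; exists B.
  by rewrite mulrA divff ?mul1r// gt_eqF.
by rewrite ler_pM2l//; exact: gM.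
Qed.

Lemma gap_le2 t h : test_function h -> gap t h <= 2.
Proof.
move=> [ch h1]; have := ev_le P1 mA t ch h1; have := ev_le P2 mA t ch h1.
rewrite /gap !ler_norml; lra.
Qed.

Lemma gap_cvg t C (h_ : nat -> 'rV[R]_d -> R) h :
  (forall n, continuous (h_ n)) -> (forall n x, `|h_ n x| <= C) ->
  (forall x, h_ n x @[n --> \oo] --> h x) ->
  gap t (h_ n) @[n --> \oo] --> gap t h.
Proof.
move=> ch hC h_cvg; apply: cvgB.
  exact: (@ev_cvg R d P1 A mA (fun=> t) t C).
exact: (@ev_cvg R d P2 A mA (fun=> t) t C).
Qed.

End two_solutions.

(** * Contraction of the gap over a short time *)

Section short_time.
Context (R : realType) (d : nat) (a : 'rV[R]_d -> 'M[R]_d) (Lm LM K beta : R).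
Hypothesis a_sym : forall x, (a x)^T = a x.
Hypotheses (Lm0 : 0 < Lm) (LmM : Lm <= LM).
Hypothesis a_ell : forall x z, Lm * normsq z <= quad (a x) z /\ quad (a x) z <= LM * normsq z.
Hypotheses (K0 : 0 < K) (beta0 : 0 < beta) (beta1 : beta <= 1).
Hypothesis a_holder : forall i j x y, `|a x i j - a y i j| <= K * normsq (x - y) `^ beta.

Let martingales (P : probability (Omega R d) R) := forall f : 'rV[R]_d -> R, Cb2 f ->
  martingale P (@coord_filtration R d)
    (fun t omega =>
       f (coord_process t omega) - f (coord_process 0 omega) -
       (\int[@lebesgue_measure R]_(s in `[0, t]) generator a f (coord_process s omega))%R).

Section propagation.
Context (P1 P2 : probability (Omega R d) R).
Hypotheses (mart1 : martingales P1) (mart2 : martingales P2).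
Context (CH : R) (CH0 : 0 < CH).
Hypothesis kern_sum : forall N L delta T x (f : 'rV[R]_d -> R),
  0 < delta -> delta ^+ 2 <= T -> (forall y, `|f y| <= 1) ->
  `|\sum_(k : {ffun 'I_d -> 'I_N}) f (grid_point delta L k) *
      (delta ^+ d * kern a (grid_point delta L k) T x)| <= CH * T `^ (beta - 1).
Context (s0 t M : R) (A : set (Omega R d)).
Hypotheses (s0_ge0 : 0 <= s0) (FA : coord_filtration s0 A) (s0t : s0 < t) (M0 : 0 <= M).
Hypothesis gap_s0 : forall h, test_function h -> gap P1 P2 A s0 h <= 0.
Hypothesis gap_M : forall s h, s0 < s < t -> test_function h -> gap P1 P2 A s h <= M.

(** Monotonicity replaces integration in time: [phi] is the gap of the evolving sum [g_s], its
    derivative is bounded by [M * CH * T^(beta - 1)], and adding a multiple of [T^beta] gives a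
    nonincreasing [psi], compared at [s0] and [t]. *)
Lemma gap_approx_le n f : test_function f ->
  gap P1 P2 A t (approx a n f) <= M * CH / beta * (mesh R n ^+ 2 + (t - s0)) `^ beta.
Proof.
move=> [cf f1]; have mA := coord_filtration_measurable s0_ge0 FA.
have mesh0 : 0 < mesh R n by rewrite invr_gt0.
set eps := mesh R n ^+ 2; have eps0 : 0 < eps by rewrite exprn_gt0.
pose T s := eps + (t - s).
have Tge s : s <= t -> eps <= T s by move=> st; rewrite lerDl subr_ge0.
have T0 s : s <= t -> 0 < T s by move=> /Tge; exact: lt_le_trans.
have dT (s : R) : is_derive s 1 T (-1).
  have h : is_derive s 1 (cst eps + (cst t - id) : R -> R) (-1).
    apply: (is_derive_eq (is_deriveD (is_derive_cst eps s 1)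
      (is_deriveB (is_derive_cst t s 1) (is_derive_id s 1)))).
    by rewrite !add0r.
  exact: h.
pose y (k : {ffun 'I_d -> 'I_(2 * n.+1 ^ 2).+1}) : 'rV[R]_d := grid_point (mesh R n) (n.+1 ^ 2) k.
pose wt k := f (y k) * mesh R n ^+ d.
pose phi s := \sum_k wt k * gap P1 P2 A s (frozen a (y k) (T s)).
(* With this factor the derivative of [kap * T s ^ beta] in [s] is exactly
   [- M * CH * T s ^ (beta - 1)]. *)
pose kap := M * CH / beta.
have kap0 : 0 <= kap by exact: divr_ge0 (mulr_ge0 M0 (ltW CH0)) (ltW beta0).
pose psi s := phi s + kap * T s `^ beta.
have bF k s : s <= t -> bounded_continuous (frozen a (y k) (T s)).
  by move=> st; exact: (frozen_bounded_continuous a_sym Lm0 LmM a_ell (y k) (T0 s st)).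
have phiE s : s <= t -> phi s = gap P1 P2 A s (fun x => \sum_k wt k * frozen a (y k) (T s) x).
  by move=> st; rewrite (gap_sum P1 P2 mA s _ wt (fun k => bF k s st)).
have dphi (s : R) : s0 < s < t -> is_derive s 1 phi
    (gap P1 P2 A s (fun x => \sum_k wt k * kern a (y k) (T s) x)).
  move=> sI; have st : s <= t by case/andP: sI => _ /ltW.
  have bk k : bounded_continuous (kern a (y k) (T s)).
    exact: (kern_bounded_continuous a_sym Lm0 LmM a_ell K0 beta0 beta1 a_holder (y k) (T0 s st)).
  rewrite (gap_sum P1 P2 mA s _ wt bk); apply: is_derive_bigsum => k.
  have d1 := is_derive_ev_frozen a_sym Lm0 LmM a_ell K0 beta0 beta1 a_holder mart1 (y k) s0_ge0 FA eps0 sI.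
  have d2 := is_derive_ev_frozen a_sym Lm0 LmM a_ell K0 beta0 beta1 a_holder mart2 (y k) s0_ge0 FA eps0 sI.
  exact: (is_deriveZ (wt k) (is_deriveB d1 d2)).
have dpsi (s : R) : s0 < s < t -> is_derive s 1 psi
    (gap P1 P2 A s (fun x => \sum_k wt k * kern a (y k) (T s) x) - M * (CH * T s `^ (beta - 1))).
  move=> sI; have st : s <= t by case/andP: sI => _ /ltW.
  have dp := is_deriveZ kap (is_derive1_comp (is_derive1_powR beta (T0 s st)) (dT s)).
  apply: (is_derive_eq (is_deriveD (dphi s sI) dp)); congr (_ + _).
  by rewrite /kap /GRing.scale/=; field; rewrite gt_eqF.
have psi_cont : {within `[s0, t], continuous psi}.
  apply: continuous_in_subspaceT => s; rewrite inE/= in_itv/= => /andP[s0s st].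
  apply: cvgD.
    apply: (cvg_big (op := +%R)) => //; first exact: add_continuous.
    move=> k _; apply: cvgMl_tmp; apply: cvgB.
      exact: (@ev_frozen_continuous R d a Lm LM a_sym Lm0 LmM a_ell P1 s0 t eps A (y k) s0_ge0 FA eps0 s st).
    exact: (@ev_frozen_continuous R d a Lm LM a_sym Lm0 LmM a_ell P2 s0 t eps A (y k) s0_ge0 FA eps0 s st).
  apply: cvgMl_tmp; have [dp _] := is_derive1_comp (is_derive1_powR beta (T0 s st)) (dT s).
  have h : {for s, continuous ((fun x : R => x `^ beta) \o T)}.
    by apply/differentiable_continuous/derivable1_diffP; exact: dp.
  exact: h.
have psi_le : psi t <= psi s0.
  apply: (@ler0_derive1_le_cc R psi s0 t _ _ psi_cont) => [s|s|||].
  - by rewrite in_itv/= => sI; have [] := dpsi s sI.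
  - rewrite in_itv/= => sI; have [_ dv] := dpsi s sI; rewrite derive1E dv subr_le0.
    have st : s <= t by case/andP: sI => _ /ltW.
    have bk k : bounded_continuous (kern a (y k) (T s)).
      exact: (kern_bounded_continuous a_sym Lm0 LmM a_ell K0 beta0 beta1 a_holder (y k) (T0 s st)).
    rewrite [leRHS]mulrC; apply: (gap_scaled mA).
    + exact: (bounded_continuous_sum _ wt bk).1.
    + by rewrite mulr_gt0// powR_gt0// T0.
    + move=> x; have := kern_sum (2 * n.+1 ^ 2).+1 (n.+1 ^ 2) x mesh0 (Tge s st) f1.
      by under eq_bigr => k _ do rewrite mulrA.
    + by move=> g; exact: gap_M.
  - by rewrite in_itv/= lexx ltW.
  - by rewrite in_itv/= lexx ltW.
  - exact: ltW.
(* At [s = t] the Gaussian time is [eps = mesh ^ 2], the one built into [approx]. *)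
have phit : phi t = gap P1 P2 A t (approx a n f).
  rewrite phiE//; congr gap; apply/funext => x; rewrite /approx; apply: eq_bigr => k _.
  by rewrite /T subrr addr0 mulrA.
(* Scaling with the bound 0 on the gap at [s0]; [|C| + 1] is just a positive bound of the sum. *)
have phi0 : phi s0 <= 0.
  rewrite phiE ?(ltW s0t)//.
  have [cS [C SC]] := bounded_continuous_sum (index_enum _) wt (fun k => bF k s0 (ltW s0t)).
  apply: (@le_trans _ _ ((`|C| + 1) * 0)); last by rewrite mulr0.
  apply: (gap_scaled mA cS); [by rewrite ltr_wpDl| |exact: gap_s0].
  by move=> x; apply: le_trans (SC x) _; rewrite (le_trans (ler_norm C))// lerDl.
rewrite -phit; apply: (@le_trans _ _ (psi t)).
  by rewrite lerDl mulr_ge0 ?powR_ge0.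
by apply: (le_trans psi_le); rewrite /psi gerDr.
Qed.

End propagation.

Lemma approx_continuous n f : continuous (approx a n f).
Proof.
apply: continuous_sum => k; apply: continuous_mulf; first exact: continuous_cstf.
by apply: continuous_mulf; [exact: continuous_cstf|exact: gauss_continuous].
Qed.

(* If [f] almost maximizes [gap] over test functions, then multiplying it by a
   weight [N >= c0] cannot decrease [gap] much below [c0 * m]: otherwise
   [f - D^-1 * (N - c0) * f] would be a test function beating the supremum. *)
Lemma gap_weighted_ge (P1 P2 : probability (Omega R d) R) (A : set (Omega R d)) t m c0 D gam f
    (N : 'rV[R]_d -> R) : measurable A ->
  0 < c0 -> 0 < D -> continuous N -> (forall x, c0 <= N x <= D) -> test_function f ->
  (forall h, test_function h -> gap P1 P2 A t h <= m) -> m - gam <= gap P1 P2 A t f ->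
  c0 * (m - gam) - D * gam <= gap P1 P2 A t (fun x => N x * f x).
Proof.
move=> mA c00 D0 cN NcD [cf f1] gm fm.
pose g x := (N x - c0) * f x.
have cg : continuous g.
  by apply: continuous_mulf => //; apply: continuous_subf => //; exact: continuous_cstf.
have Nx x : 0 <= N x - c0 <= D by case/andP: (NcD x) => h1 h2; rewrite subr_ge0 h1/=; lra.
have bg : bounded_continuous g.
  split=> //; exists D => x; rewrite normrM; case/andP: (Nx x) => h1 h2.
  by rewrite (ger0_norm h1) -[leRHS]mulr1 ler_pM.
have bf : bounded_continuous f by split => //; exists 1.
have tf' : test_function (fun x => f x + (- D^-1) * g x).
  split; first by apply: continuous_addf => //; apply: continuous_mulf => //; exact: continuous_cstf.
  move=> x; have -> : f x + - D^-1 * g x = (1 - (N x - c0) / D) * f x by rewrite /g; ring.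
  case/andP: (Nx x) => h1 h2; have q0 : 0 <= (N x - c0) / D by rewrite divr_ge0// ltW.
  have q1 : (N x - c0) / D <= 1 by rewrite ler_pdivrMr// mul1r.
  by rewrite normrM ger0_norm ?subr_ge0// mulr_ile1 ?subr_ge0// gerBl.
have := gm _ tf'; rewrite gapD//; last exact: bounded_continuousZ.
rewrite gapZ// => h1.
have -> : gap P1 P2 A t (fun x => N x * f x) = gap P1 P2 A t (fun x => c0 * f x + g x).
  by congr gap; apply/funext => x; rewrite /g; ring.
rewrite gapD//; last exact: bounded_continuousZ.
rewrite gapZ//.
move: h1 fm; move: (gap _ _ _ _ f) (gap _ _ _ _ g) => u v h1 fm.
have : D * (u - m) <= v.
  by rewrite -ler_pdivlMl// mulrC; lra.
have : c0 * (m - gam) <= c0 * u by rewrite ler_pM2l.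
have : D * (- gam) <= D * (u - m) by rewrite ler_pM2l//; lra.
lra.
Qed.

Lemma short_time_uniqueness : exists2 tau : R, 0 < tau &
  forall (P1 P2 : probability (Omega R d) R) s0 (A : set (Omega R d)),
    martingales P1 -> martingales P2 -> 0 <= s0 -> coord_filtration s0 A ->
    (forall h, test_function h -> gap P1 P2 A s0 h = 0) ->
    forall t h, s0 <= t <= s0 + tau -> test_function h -> gap P1 P2 A t h = 0.
Proof.
have [CH CH0 kern_sum] := kern_sum_le a_sym Lm0 LmM a_ell K0 beta0 beta1 a_holder.
have [Cw Cw0 app_le] := weighted_approx_le a_sym Lm0 LmM a_ell.
pose c0 := expR (- (d%:R / (4 * Lm))); have c00 : 0 < c0 by exact: expR_gt0.
pose D := Cw + c0; have D0 : 0 < D by rewrite addr_gt0.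
(* Solves [M * CH / beta * r = c0 * M / 2]. *)
pose r := c0 * beta / (2 * CH).
have r0 : 0 < r by rewrite divr_gt0// mulr_gt0.
(* So that [(2 * tau) ^ beta = r]: one [tau] is for [t - s0], the other for [mesh ^ 2]. *)
pose tau := r `^ beta^-1 / 2.
have tau0 : 0 < tau by rewrite divr_gt0// powR_gt0.
exists tau => // P1 P2 s0 A mart1 mart2 s0_ge0 FA gap_s0.
have mA := coord_filtration_measurable s0_ge0 FA.
have app1 n f x : (forall y, `|f y| <= 1) -> `|approx a n f x| <= Cw.
  move=> f1; rewrite -[Cw]mul1r; apply: app_le => // y; rewrite mul1r.
  by rewrite (le_trans (f1 y))// lerDl divr_ge0 ?normsq_ge0// sqr_ge0.
have halve M : 0 <= M ->
    (forall t h, s0 <= t <= s0 + tau -> test_function h -> gap P1 P2 A t h <= M) ->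
    forall t h, s0 <= t <= s0 + tau -> test_function h -> gap P1 P2 A t h <= M / 2.
  move=> M0 gM t h /andP[s0t tt] th.
  move: s0t; rewrite le_eqVlt => /orP[/eqP <-|s0t].
    by rewrite gap_s0// divr_ge0.
  pose S := [set z : R | exists2 g, test_function g & gap P1 P2 A t g = z].
  have SM : ubound S M.
    by move=> _ [g tg <-]; apply: gM => //; rewrite (ltW s0t).
  have supS : has_sup S by split; [exists (gap P1 P2 A t h), h|exists M].
  apply: (@le_trans _ _ (sup S)); first by apply: ub_le_sup; [exists M|exists h].
  (* [gam] is the slack both in attaining the supremum and in replacing [approx n f] by [N n * f];
     it tends to 0 afterwards. *)
  have key gam : 0 < gam -> c0 * sup S <= c0 * (M / 2) + (c0 + D + 1) * gam.
    move=> gam0; have [_ [f tf <-] fS] := sup_adherent gam0 supS.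
    have [cf f1] := tf.
    (* The lower bound [c0] of the weight holds at each [x] only from some [n] on, while
       [gap_weighted_ge] asks for it everywhere. The maximum enforces it and is eventually inactive
       at each point, which is enough for bounded convergence. *)
    pose N n x := Num.max (approx a n (fun=> 1) x) c0.
    have cN n : continuous (N n).
      move=> x; apply: continuous_max; [exact: approx_continuous|exact: continuous_cstf].
    have NcD n x : c0 <= N n x <= D.
      rewrite le_max lexx orbT/= ge_max lerDr (ltW Cw0) andbT.
      apply: le_trans (ler_norm _) _; apply: le_trans (app1 n _ x _) _ => [y|].
        by rewrite normr1.
      by rewrite lerDl ltW.
    have bound n x : `|N n x * f x| <= D.
      case/andP: (NcD n x) => h1 h2; rewrite normrM ger0_norm ?(le_trans (ltW c00))//.
      by rewrite -[leRHS]mulr1 ler_pM// (le_trans (ltW c00)).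
    have bNf n : bounded_continuous (fun x => N n x * f x).
      by split; [exact: continuous_mulf|exists D].
    have bapp n : bounded_continuous (approx a n f).
      by split; [exact: approx_continuous|exists Cw => x; exact: app1].
    have diff_cvg : gap P1 P2 A t (fun x => approx a n f x + (-1) * (N n x * f x)) @[n --> \oo] -->
        gap P1 P2 A t (fun=> 0).
      apply: (@gap_cvg R d P1 P2 A mA t (Cw + D)) => [n|n x|x].
      - by have [] := bounded_continuousD (bapp n) (bounded_continuousZ (-1) (bNf n)).
      - by rewrite mulN1r (le_trans (ler_normB _ _))// lerD// app1.
      - have := approx_error a_sym Lm0 LmM a_ell x cf f1.
        apply: cvg_trans; apply: near_eq_cvg.
        apply: filterS (approx_ge Lm0 a_ell x) => n nx.
        by rewrite /N max_l// mulN1r.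
    have gap0 : gap P1 P2 A t (fun=> 0) = 0.
      have := gapZ P1 P2 mA t 0 (test_bounded_continuous tf); rewrite mul0r => E.
      by rewrite -[RHS]E; congr gap; apply/funext => x; rewrite mul0r.
    rewrite gap0 in diff_cvg.
    have mesh_cvg : mesh R n ^+ 2 @[n --> \oo] --> (0 : R).
      by rewrite -(mulr0 0); apply: cvgM; exact: cvg_harmonic.
    near \oo => n.
    have h1 : - gam <= gap P1 P2 A t (fun x => approx a n f x + (-1) * (N n x * f x)).
      by near: n; apply: (cvgr_ge 0 diff_cvg); rewrite oppr_lt0.
    have h2 : mesh R n ^+ 2 <= tau by near: n; exact: (cvgr_le 0 mesh_cvg).
    rewrite gapD// in h1; last exact: bounded_continuousZ.
    rewrite gapZ// in h1.
    have h3 := @gap_approx_le P1 P2 mart1 mart2 CH CH0 kern_sum s0 t M A s0_ge0 FA s0t M0 _ _ n f tf.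
    have h4 := @gap_weighted_ge P1 P2 A t (sup S) c0 D gam f (N n) mA c00 D0 (cN n) (NcD n) tf _ (ltW fS).
    have {}h3 : gap P1 P2 A t (approx a n f) <= M * c0 / 2.
      apply: le_trans (h3 _ _) _.
      - by move=> g tg; rewrite gap_s0.
      - by move=> s g /andP[ss st] tg; apply: gM => //; rewrite (ltW ss) (le_trans (ltW st)).
      - apply: (@le_trans _ _ (M * CH / beta * r)); last first.
          by rewrite le_eqVlt; apply/orP; left; apply/eqP; rewrite /r; field; rewrite !gt_eqF.
        rewrite ler_wpM2l ?divr_ge0 ?mulr_ge0 ?(ltW CH0) ?(ltW beta0)//.
        have -> : r = (2 * tau) `^ beta.
          by rewrite /tau mulrC divfK// -powRrM mulVf ?gt_eqF// powRr1// ltW.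
        apply: ge0_ler_powR; rewrite ?nnegrE ?(ltW beta0)//.
        + by rewrite addr_ge0 ?sqr_ge0// subr_ge0 ltW.
        + by rewrite mulr_ge0// ltW.
        + by lra.
    have {}h4 := h4 (fun g tg => ub_le_sup (ex_intro _ M SM) (ex_intro2 _ _ g tg erefl)).
    move: h1 h3 h4; move: (gap _ _ _ _ _) (gap _ _ _ _ _) (sup S) => u v m h1 h3 h4.
    nra.
  rewrite -(ler_pM2l c00); apply/ler_addgt0Pr => e e0.
  have E0 : 0 < c0 + D + 1 by rewrite addr_gt0// addr_gt0.
  have := key (e / (c0 + D + 1)) (divr_gt0 e0 E0).
  by rewrite mulrC [_ * (e / _)]mulrC divfK ?gt_eqF// mulrC.
have small n t h : s0 <= t <= s0 + tau -> test_function h -> gap P1 P2 A t h <= 2 * 2^-1 ^+ n.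
  elim: n t h => [|n IH] t h tI th.
    by rewrite expr0 mulr1; exact: gap_le2.
  have M0 : 0 <= 2 * 2^-1 ^+ n :> R by rewrite mulr_ge0// exprn_ge0// invr_ge0.
  by rewrite exprSr mulrA; exact: (halve _ M0 IH t h tI th).
have le0 t h : s0 <= t <= s0 + tau -> test_function h -> gap P1 P2 A t h <= 0.
  move=> tI th; have lim0 : 2 * 2^-1 ^+ n @[n --> \oo] --> (0 : R).
    rewrite -[X in _ --> X](mulr0 2); apply: cvgMl_tmp; apply: cvg_expr.
    by rewrite ger0_norm ?invr_ge0// invf_lt1// ltr1n.
  by apply: (cvgr_to_ge lim0); apply: nearW => n; exact: small.
move=> t h tI th; apply/eqP; rewrite eq_le le0//=.
(* The opposite inequality comes from [- h]. *)
have tN : test_function (fun x => (-1) * h x).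
  case: th => ch h1; split; first by apply: continuous_mulf => //; exact: continuous_cstf.
  by move=> x; rewrite mulN1r normrN.
have := le0 t _ tI tN; rewrite gapZ; last exact: test_bounded_continuous.
  by rewrite mulN1r oppr_le0.
by [].
Unshelve. all: by end_near. Qed.

End short_time.

(** * Finite-dimensional distributions *)

Section distance_to_complement.
Context (R : realType) (V : normedModType R) (U : set V).
Hypotheses (oU : open U) (UC : (~` U) !=set0).

Let dists (x : V) : set R := [set z | exists2 y, (~` U) y & `|x - y| = z].

Let dist (x : V) : R := inf (dists x).

Let dists_inf x : has_inf (dists x).
Proof.
split; first by have [y Uy] := UC; exists `|x - y|, y.
by exists 0 => _ [y _ <-].
Qed.

Let dist_le x y : (~` U) y -> dist x <= `|x - y|.
Proof. by move=> Uy; apply: ge_inf; [have [] := dists_inf x|exists y]. Qed.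

Let dist_ge0 x : 0 <= dist x.
Proof. by apply: lb_le_inf; [have [] := dists_inf x|move=> _ [y _ <-]]. Qed.

Let dist_lip x y : dist x <= `|x - y| + dist y.
Proof.
rewrite -lerBlDl; apply: lb_le_inf; first by have [] := dists_inf y.
move=> _ [z Uz <-]; rewrite lerBlDl (le_trans (dist_le x Uz))//.
by rewrite -[x - z](subrKA y) ler_normD.
Qed.

Let dist_continuous : continuous dist.
Proof.
move=> x; apply/cvgrPdist_le => e e0; near=> y.
apply: (@le_trans _ _ `|x - y|); last first.
  by near: y; exact: cvgr_dist_le.
rewrite ler_norml; have := dist_lip x y; have := dist_lip y x; rewrite (distrC y x).
move: (dist x) (dist y) `|x - y| => p q r; lra.
Unshelve. all: by end_near. Qed.

Let dist_gt0 x : U x -> 0 < dist x.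
Proof.
move=> Ux; have /nbhs_ballP[e /= e0 eU] : nbhs x U by exact: open_nbhs_nbhs.
apply: lt_le_trans e0 _; apply: lb_le_inf; first by have [] := dists_inf x.
move=> _ [y Uy <-]; rewrite leNgt; apply/negP => xy; apply: Uy; apply: eU.
by rewrite -ball_normE.
Qed.

Let dist_eq0 x : (~` U) x -> dist x = 0.
Proof. by move=> Ux; apply/eqP; rewrite eq_le dist_ge0 andbT -(normr0 V) -(subrr x) dist_le. Qed.

(** Multiples of the distance to the complement, truncated at 1: the distance vanishes off [U] and,
    [U] being open, is positive on it. *)
Lemma proper_open_indicator_approx : exists f : nat -> V -> R,
  [/\ forall n, continuous (f n), forall n x, 0 <= f n x <= 1 &
      forall x, f n x @[n --> \oo] --> (\1_U x : R)].
Proof.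
exists (fun n x => Num.min (n%:R * dist x) 1); split=> [n x|n x|x].
- apply: (@continuous_min _ _ (fun x => n%:R * dist x) (fun=> 1)); last exact: continuous_cstf.
  by apply: continuous_mulf; [exact: continuous_cstf|exact: dist_continuous].
- by rewrite le_min ler01 ge_min lexx orbT mulr_ge0.
- have [Ux|Ux] := pselect (U x); last first.
    rewrite indicE memNset// (_ : (fun n => _) = cst 0); first exact: cvg_cst.
    by apply/funext => n; rewrite dist_eq0// mulr0 min_l.
  rewrite indicE mem_set//=; apply: cvg_near_cst.
  have d0 := dist_gt0 Ux; near=> n; apply: min_r.
  rewrite -ler_pdivrMr// div1r; near: n; exact: nbhs_infty_ger.
Unshelve. all: by end_near. Qed.

End distance_to_complement.

(** For the whole space the distance would be an infimum over the empty set; there the constant 1 is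
    taken. *)
Lemma open_indicator_approx (R : realType) (V : normedModType R) (U : set V) :
  open U -> exists f : nat -> V -> R,
  [/\ forall n, continuous (f n), forall n x, 0 <= f n x <= 1 &
      forall x, f n x @[n --> \oo] --> (\1_U x : R)].
Proof.
move=> oU; have [UC|/set0P] := eqVneq (~` U) set0; last exact: proper_open_indicator_approx.
exists (fun _ _ => 1); split=> [n|n x|x]; first exact: continuous_cstf.
  by rewrite ler01 lexx.
by rewrite -(setCK U) UC setC0 indicE in_setT; exact: cvg_cst.
Qed.

Lemma clipped_pathE (R : realType) (d : nat) (t : R) (omega : Omega R d) :
  0 <= t -> clipped_path t omega = coord_process t omega.
Proof. by move=> t0; rewrite /clipped_path max_l. Qed.

Section gap_events.
Context (R : realType) (d : nat) (P1 P2 : probability (Omega R d) R).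

Lemma ev_setI (P : probability (Omega R d) R) (A : set (Omega R d)) s (U : set 'rV[R]_d)
    (f : nat -> 'rV[R]_d -> R) h : measurable A -> 0 <= s ->
  (forall n, continuous (f n)) -> (forall n x, 0 <= f n x <= 1) ->
  (forall x, f n x @[n --> \oo] --> (\1_U x : R)) -> test_function h ->
  ev P A s (fun x => f n x * h x) @[n --> \oo] -->
  ev P (A `&` @coord_process R d s @^-1` U) s h.
Proof.
move=> mA s0 cf f1 fU [ch h1].
rewrite /ev Rintegral_mkcondr.
apply: (@bounded_Rintegral_cvg _ _ R P A _ _ 1 mA) => [n|n omega|omega].
- by apply: (@measurable_clipped_path R d s (fun x => f n x * h x)); exact: continuous_mulf.
- case/andP: (f1 n (clipped_path s omega)) => f0 fl1.
  by rewrite normrM ger0_norm// mulr_ile1.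
- rewrite patchE; have := fU (clipped_path s omega); rewrite indicE.
  have -> : (omega \in @coord_process R d s @^-1` U) = (clipped_path s omega \in U).
    by rewrite clipped_pathE// /in_mem.
  case: ifP => _ cv.
    by rewrite -[X in _ --> X]mul1r; apply: cvgM => //; exact: cvg_cst.
  by rewrite -[X in _ --> X](mul0r (h (clipped_path s omega))); apply: cvgM => //; exact: cvg_cst.
Qed.

(** If [f n] increases the constraint to the indicator of [U], then [f n * h] is still a test
    function, with zero gap over [A]; the limit in [n] turns the factor [f n] into the event. *)
Lemma gap_setI (A : set (Omega R d)) s (U : set 'rV[R]_d) : measurable A -> 0 <= s -> open U ->
  (forall h, test_function h -> gap P1 P2 A s h = 0) ->
  forall h, test_function h -> gap P1 P2 (A `&` @coord_process R d s @^-1` U) s h = 0.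
Proof.
move=> mA s0 oU gap0 h th; have [f [cf f1 fU]] := @open_indicator_approx R 'rV[R]_d U oU.
have c1 := @ev_setI P1 A s U f h mA s0 cf f1 fU th.
have c2 := @ev_setI P2 A s U f h mA s0 cf f1 fU th.
have c3 : gap P1 P2 A s (fun x => f n x * h x) @[n --> \oo] -->
    gap P1 P2 (A `&` @coord_process R d s @^-1` U) s h by exact: (cvgB c1 c2).
have E : (fun n => gap P1 P2 A s (fun x => f n x * h x)) = cst 0.
  apply/funext => n; apply: gap0; case: th => ch h1; split; first exact: continuous_mulf.
  by move=> x; case/andP: (f1 n x) => f0 fl1; rewrite normrM ger0_norm// mulr_ile1.
rewrite E in c3.
exact: (@cvg_unique _ (@Rhausdorff R) _ _ _ _ c3 (cvg_cst (0 : R))).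
Qed.

Lemma gap_initial w : P1 [set omega | coord_process 0 omega = w] = 1%E ->
  P2 [set omega | coord_process 0 omega = w] = 1%E ->
  forall h, test_function h -> gap P1 P2 setT 0 h = 0.
Proof.
have E (P : probability (Omega R d) R) h : P [set omega | coord_process 0 omega = w] = 1%E ->
    test_function h -> ev P setT 0 h = h w.
  move=> Pw [ch h1]; set W : set (Omega R d) := [set omega | coord_process 0 omega = w].
  have mn : measurable_fun setT (fun omega : Omega R d => normsq (coord_process 0 omega - w)).
    exact: (measurable_coord_process (lexx 0) (@normsq_continuous R d w)).
  (* The initial event is the zero set of a continuous function of [X_0]. *)
  have mW : measurable W.
    have := mn measurableT _ (measurable_set1 0); rewrite setTI; congr measurable.
    apply/seteqP; split=> omega /=; last first.
      by move=> ->; rewrite subrr /normsq big1// => k _; rewrite mxE expr0n.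
    by move=> /normsq_eq0/eqP; rewrite subr_eq0 => /eqP.
  have -> : ev P setT 0 h = \int[P]_(omega in setT) h w.
    rewrite /ev /Rintegral; congr fine; apply: ae_eq_integral => //.
    - by apply/measurable_EFinP; exact: measurable_clipped_path.
    - exists (~` W); split; first exact: measurableC.
        by have := probability_setC P mW; rewrite Pw subee.
      by move=> omega /= nE WE; apply: nE => _; rewrite clipped_pathE// WE.
  transitivity (h w * fine (P setT)); first exact: (Rintegral_cst P measurableT (h w)).
  by have -> : P setT = 1%E; [exact: probability_setT|rewrite mulr1].
by move=> h1 h2 h th; rewrite /gap !E// subrr.
Qed.

Lemma gap_events (A : set (Omega R d)) s : measurable A ->
  (forall h, test_function h -> gap P1 P2 A s h = 0) -> P1 A = P2 A.
Proof.
move=> mA /(_ (fun=> 1)).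
have t1 : test_function (fun _ : 'rV[R]_d => 1 : R).
  by split; [exact: continuous_cstf|move=> x; rewrite normr1].
move=> /(_ t1); rewrite /gap /ev !(Rintegral_cst _ mA) !mul1r => /eqP; rewrite subr_eq0 => /eqP E.
by rewrite -(fineK (fin_num_measure P1 A mA)) E fineK// fin_num_measure.
Qed.

End gap_events.

(** * Open cylinders as an intersection-stable generating family *)

Definition open_cylinder (R : realType) (d n : nat) (t : 'I_n -> R) (U : 'I_n -> set 'rV[R]_d)
    (ks : seq 'I_n) : set (Omega R d) :=
  [set omega | forall k, k \in ks -> U k (coord_process (t k) omega)].

Definition open_cylinders (R : realType) (d : nat) : set (set (Omega R d)) :=
  [set C | exists (n : nat) (t : 'I_n -> R) (U : 'I_n -> set 'rV[R]_d),
     [/\ forall k, 0 <= t k, forall k, open (U k) & C = open_cylinder t U (enum 'I_n)]].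

Lemma open_cylinders_setI (R : realType) (d : nat) : setI_closed (@open_cylinders R d).
Proof.
move=> _ _ [m [t [U [t0 oU ->]]]] [n [t' [U' [t0' oU' ->]]]].
exists (m + n)%N, (fun k => match fintype.split k with inl i => t i | inr j => t' j end),
  (fun k => match fintype.split k with inl i => U i | inr j => U' j end); split.
- by move=> k; case: fintype.split.
- by move=> k; case: fintype.split.
- apply/seteqP; split=> omega /=.
    by move=> [h h'] k _; case: fintype.split => i; [apply: h|apply: h']; rewrite mem_enum.
  move=> h; split=> k _.
    by have := h (unsplit (inl k)) (mem_enum _ _); rewrite unsplitK.
  by have := h (unsplit (inr k)) (mem_enum _ _); rewrite unsplitK.
Qed.

(** For a fixed time, the sets whose preimage is generated by open cylinders form a sigma-algebra
    containing the open sets, hence all Borel sets. Open constraints are the ones accessible to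
    continuous test functions. *)
Lemma measurable_open_cylinders (R : realType) (d : nat) :
  @measurable _ (Omega R d) = <<s @open_cylinders R d >>.
Proof.
apply/seteqP; split; last first.
  apply: smallest_sub; first exact: sigma_algebra_measurable.
  move=> _ [n [t [U [t0 oU ->]]]]; apply: sub_sigma_algebra.
  exists n, t, U; split => //; first by move=> k; apply: sub_sigma_algebra; exact: oU.
  apply/seteqP; split=> omega /=; first by move=> h k; apply: h; rewrite mem_enum.
  by move=> h k _; exact: h.
apply: smallest_sub; first exact: smallest_sigma_algebra.
pose m := <<s @open_cylinders R d >>.
have preimage_m (s : R) B : 0 <= s -> borel B -> m (@coord_process R d s @^-1` B).
  move=> s0; apply: (@smallest_sub _ _ _ (fun B => m (@coord_process R d s @^-1` B))).
    split.
    - by rewrite preimage_set0; exact: sigma_algebra0.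
    - by move=> C mC; rewrite setTD preimage_setC -setTD; exact: sigma_algebraCD.
    - by move=> F mF; rewrite preimage_bigcup; exact: sigma_algebra_bigcup.
  move=> U oU; apply: sub_sigma_algebra.
  exists 1%N, (fun=> s), (fun=> U); split => //.
  by apply/seteqP; split=> omega /=; [move=> h k|move=> /(_ ord0); apply; rewrite mem_enum].
move=> _ [n [t [B [t0 bB ->]]]].
have -> : [set omega | forall k, B k (coord_process (t k) omega)] =
    \bigcap_(k in [set: 'I_n]) (@coord_process R d (t k) @^-1` B k).
  by apply/seteqP; split=> omega /= h k; [move=> _; exact: h|exact: h].
apply: (@fin_bigcap_measurable _ (g_sigma_algebraType (@open_cylinders R d))) => // k _.
exact: preimage_m.
Qed.

Lemma coord_filtrationT (R : realType) (d : nat) (t : R) : @coord_filtration R d t setT.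
Proof.
rewrite /coord_filtration; set G := (X in <<s X >>).
exact: (@measurableT _ (g_sigma_algebraType G)).
Qed.

Lemma coord_filtration_setI (R : realType) (d : nat) (t : R) (A : set (Omega R d)) (U : set 'rV[R]_d) :
  0 <= t -> open U -> coord_filtration t A -> coord_filtration t (A `&` @coord_process R d t @^-1` U).
Proof.
move=> t0 oU; rewrite /coord_filtration; set G := (X in <<s X >>) => FA.
apply: (@measurableI _ (g_sigma_algebraType G)) => //; apply: sub_sigma_algebra.
by exists t, U; split; [rewrite t0 lexx|exact: sub_sigma_algebra|].
Qed.

(** * Propagation through finitely many times *)

Section uniqueness.
Context (R : realType) (d : nat) (a : 'rV[R]_d -> 'M[R]_d) (Lm LM K beta : R).
Hypothesis a_sym : forall x, (a x)^T = a x.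
Hypotheses (Lm0 : 0 < Lm) (LmM : Lm <= LM).
Hypothesis a_ell : forall x z, Lm * normsq z <= quad (a x) z /\ quad (a x) z <= LM * normsq z.
Hypotheses (K0 : 0 < K) (beta0 : 0 < beta) (beta1 : beta <= 1).
Hypothesis a_holder : forall i j x y, `|a x i j - a y i j| <= K * normsq (x - y) `^ beta.
Context (w : 'rV[R]_d) (P1 P2 : probability (Omega R d) R).
Hypothesis hP1 : martingale_problem_solution (generator a) w P1.
Hypothesis hP2 : martingale_problem_solution (generator a) w P2.

(** The induction invariant: [A] is known at time [s], and [X_s] restricted to [A] has the same
    distribution under both solutions, as seen by test functions. *)
Definition agree (s : R) (A : set (Omega R d)) : Prop :=
  coord_filtration s A /\ forall h, test_function h -> gap P1 P2 A s h = 0.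

(** Finitely many steps of the uniform length [tau] reach [t]; the event stays fixed while the
    filtration grows. *)
Lemma agree_later s t A : 0 <= s -> s <= t -> agree s A -> agree t A.
Proof.
have [tau tau0 step] := short_time_uniqueness a_sym Lm0 LmM a_ell K0 beta0 beta1 a_holder.
have one r u : 0 <= r -> r <= u <= r + tau -> agree r A -> agree u A.
  move=> r0 ru [FA gap0]; split; first by case/andP: ru => ru _; exact: (coord_filtrationS ru FA).
  by move=> h th; exact: (step P1 P2 r A hP1.2 hP2.2 r0 FA gap0 u h ru th).
move=> s0 st; have [n tn] : exists n : nat, t <= s + n%:R * tau.
  exists (Num.truncn ((t - s) / tau)).+1; rewrite -lerBlDl -ler_pdivrMr//.
  by rewrite ltW// truncnS_gt.
elim: n s s0 st tn => [|n IH] s s0 st tn sA.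
  by have -> : t = s by apply/eqP; rewrite eq_le st; move: tn; rewrite mul0r addr0 => ->.
have [ts|st'] := leP t (s + tau); first by apply: one sA => //; rewrite st.
apply: (IH (s + tau)).
- by rewrite addr_ge0// ltW.
- exact: ltW.
- by rewrite (le_trans tn)// -natr1; lra.
- by apply: one sA => //; rewrite lexx lerDl ltW.
Qed.

(** The list is sorted with the latest time first. Its tail agrees at the time of the head by
    induction, the head constraint is then imposed on the present position by [gap_setI], and
    [agree_later] leads on to [s]. *)
Lemma agree_cylinder n (t : 'I_n -> R) (U : 'I_n -> set 'rV[R]_d) ks s :
  (forall k, 0 <= t k) -> (forall k, open (U k)) ->
  sorted (fun k k' => t k' <= t k) ks -> 0 <= s -> (forall k, k \in ks -> t k <= s) ->
  agree s (open_cylinder t U ks).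
Proof.
move=> t0 oU; elim: ks s => [|k ks IH] s.
  move=> _ s0 _; have -> : open_cylinder t U [::] = setT.
    by apply/seteqP; split=> omega //= _ k; rewrite in_nil.
  apply: (agree_later (lexx 0) s0); split; first exact: coord_filtrationT.
  exact: (gap_initial hP1.1 hP2.1).
move=> /= ks_sorted s0 ts.
have tk k' : k' \in ks -> t k' <= t k.
  move=> k'ks; have := order_path_min _ ks_sorted.
  by move=> /(_ (fun _ _ _ h1 h2 => le_trans h2 h1))/allP/(_ k' k'ks).
have [FA gap0] := IH (t k) (path_sorted ks_sorted) (t0 k) tk.
apply: (agree_later (t0 k)); first by apply: ts; rewrite mem_head.
have -> : open_cylinder t U (k :: ks) = open_cylinder t U ks `&` @coord_process R d (t k) @^-1` U k.
  apply/seteqP; split=> omega /=.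
    move=> h; split; last by apply: h; rewrite mem_head.
    by move=> k' k'ks; apply: h; rewrite in_cons k'ks orbT.
  by move=> [h hk] k'; rewrite in_cons => /orP[/eqP ->|]; [exact: hk|exact: h].
have mA := coord_filtration_measurable (t0 k) FA; split.
  exact: (coord_filtration_setI (t0 k) (oU k) FA).
exact: (gap_setI mA (t0 k) (oU k) gap0).
Qed.

(** Finite measures are determined by an intersection-stable generating family; each open cylinder
    is first rewritten with its constraints in decreasing order of time. *)
Lemma agree_measurable (A : set (Omega R d)) : measurable A -> P1 A = P2 A.
Proof.
apply: (measure_unique (@open_cylinders R d) (fun=> setT)).
- exact: measurable_open_cylinders.
- exact: open_cylinders_setI.
- move=> _; exists 0%N, (fun=> 0), (fun=> setT); split => //; first by move=> k; exact: openT.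
  by apply/seteqP; split=> omega.
- by rewrite bigcup_const.
- move=> _ [n [t [U [t0 oU ->]]]].
  pose ks := sort (fun k k' : 'I_n => t k' <= t k) (enum 'I_n).
  have -> : open_cylinder t U (enum 'I_n) = open_cylinder t U ks.
    by apply/seteqP; split=> omega h k; [rewrite mem_sort|move=> kn]; apply: h; rewrite ?mem_sort.
  (* The sum of the nonnegative times serves as a common later time. *)
  have s0 : 0 <= \sum_k t k by apply: sumr_ge0 => k _; exact: t0.
  have ts k : k \in ks -> t k <= \sum_k t k.
    by move=> _; rewrite (bigD1 k)//= lerDl; apply: sumr_ge0 => i _; exact: t0.
  have ks_sorted : sorted (fun k k' : 'I_n => t k' <= t k) ks.
    by apply: sort_sorted => k k'; exact: le_total.
  have [FA gap0] := agree_cylinder t0 oU ks_sorted s0 ts.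
  exact: (gap_events (coord_filtration_measurable s0 FA) gap0).
- by move=> k; apply: le_lt_trans (probability_le1 _ measurableT) (ltry _).
Qed.
End uniqueness.

(* Capping the exponent at [1] (in terms of the squared norm) is harmless because
   of the truncation at [1]. *)
Lemma min_powR_enorm_le (R : realType) (d : nat) (z : 'rV[R]_d) (alpha : R) : 0 < alpha ->
  Num.min 1 (enorm z `^ alpha) <= normsq z `^ Num.min (alpha / 2) 1.
Proof.
move=> alpha0; rewrite /enorm -/(normsq z); set n := normsq z.
have n0 : 0 <= n by exact: normsq_ge0.
have -> : Num.sqrt n `^ alpha = n `^ (alpha / 2).
  by rewrite -powR12_sqrt// -powRrM mulrC.
have [a2|a2] := leP (alpha / 2) 1; first by rewrite ge_min lexx orbT.
rewrite powRr1//; have [n1|n1] := leP n 1; last by rewrite ge_min (ltW n1).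
rewrite ge_min; apply/orP; right.
move: n0; rewrite le_eqVlt => /orP[/eqP <-|n0].
  by rewrite powR0// gt_eqF// divr_gt0.
by rewrite -[leRHS]powRr1 ?(ltW n0)//; apply: ger_powR; rewrite ?n0// ltW.
Qed.

Theorem theorem1p1 (R : realType) (d : nat) (hd : (1 <= d)%N)
    (a : 'rV[R]_d -> 'M[R]_d)
    (a_sym : forall x, (a x)^T = a x)
    (Lambda_m Lambda_M : R)
    (hLambda_m : 0 < Lambda_m) (hLambda : Lambda_m <= Lambda_M)
    (a_elliptic : forall x z : 'rV[R]_d,
       Lambda_m * (\sum_(i < d) z 0 i ^+ 2) <=
         \sum_(i < d) \sum_(j < d) a x i j * z 0 i * z 0 j /\
       \sum_(i < d) \sum_(j < d) a x i j * z 0 i * z 0 j <=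
         Lambda_M * (\sum_(i < d) z 0 i ^+ 2))
    (K alpha : R) (hK : 0 < K) (halpha : 0 < alpha)
    (a_holder : forall (i j : 'I_d) (x y : 'rV[R]_d),
       `|a x i j - a y i j| <= K * Num.min 1 (enorm (x - y) `^ alpha))
    (w : 'rV[R]_d) (P1 P2 : probability (Omega R d) R)
    (hP1 : martingale_problem_solution (generator a) w P1)
    (hP2 : martingale_problem_solution (generator a) w P2) :
  forall A : set (Omega R d), measurable A -> P1 A = P2 A.
Proof.
move=> A mA.
(* The Hoelder exponent relative to [normsq]: half of [alpha], capped at 1. *)
have beta0 : 0 < Num.min (alpha / 2) 1 by rewrite lt_min divr_gt0//=.
have beta1 : Num.min (alpha / 2) 1 <= 1 by rewrite ge_min lexx orbT.
have holder i j x y : `|a x i j - a y i j| <= K * normsq (x - y) `^ Num.min (alpha / 2) 1.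
  by rewrite (le_trans (a_holder i j x y))// ler_pM2l// min_powR_enorm_le.
exact: (agree_measurable a_sym hLambda_m hLambda a_elliptic hK beta0 beta1 holder hP1 hP2 mA).
Qed.
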